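(* Consider the control system $y'(t)=f(y(t),u(t))$, $u(t)\in U$, the compact state constraint set $Y\subset\mathbb{R}^m$ on which the system is viable, the running cost $k$, the optimal values $V_T(y_0)$, $h_\lambda(y_0)$, and the optimal value $k^*(y_0)$ of the infinite dimensional linear programming problem defined in the context. Let $\delta_0>0$ and let (A1)–(A7) denote the properties listed in the context. (a) If (A1), (A2), (A4) and (A5) hold, then $$\limsup_{T\to\infty}V_T(y_0)\le k^*(y_0)\qquad\text{for all } y_0\in Y.$$ (b) If (A1), (A3), (A6) and (A7) hold, then $$\limsup_{\lambda\downarrow 0}h_\lambda(y_0)\le k^*(y_0)\qquad\text{for all } y_0\in Y.$$
   Context: Setting. $U$ is a compact metric space; $f:\mathbb{R}^m\times U\to\mathbb{R}^m$ is continuous and Lipschitz in $y$ uniformly in $u\in U$; $k:\mathbb{R}^m\times U\to\mathbb{R}$ is continuous. $\mathcal{U}$ is the set of measurable functions $u:[0,\infty)\to U$, and $y(\cdot,y_0,u)$ is the solution of $y'(t)=f(y(t),u(t))$, $y(0)=y_0$. $Y\subset\mathbb{R}^m$ is a nonempty compact set equal to the closure of its interior. $\mathcal{U}_T(y_0)$ (resp. $\mathcal{U}(y_0)$) is the set of $u\in\mathcal{U}$ with $y(t,y_0,u)\in Y$ for all $t\in[0,T]$ (resp. all $t\ge 0$). Standing assumption (viability): $\mathcal{U}(y_0)\ne\emptyset$ for every $y_0\in Y$. Optimal values: for $T,\lambda>0$, $$V_T(y_0)=\frac1T\inf_{u\in\mathcal{U}_T(y_0)}\int_0^T k(y(t,y_0,u),u(t))\,dt,\qquad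 h_\lambda(y_0)=\lambda\inf_{u\in\mathcal{U}(y_0)}\int_0^\infty e^{-\lambda t}k(y(t,y_0,u),u(t))\,dt.$$ Measures. $\mathcal{P}(Y\times U)$ and $\mathcal{M}_+(Y\times U)$ are the Borel probability measures and the finite nonnegative Borel measures on $Y\times U$. $C^1$ is the space of continuously differentiable functions $\mathbb{R}^m\to\mathbb{R}$; gradients are row vectors. $$W=\Big\{\gamma\in\mathcal{P}(Y\times U):\int_{Y\times U}\nabla\phi(y)f(y,u)\,\gamma(dy,du)=0\ \ \forall\phi\in C^1\Big\}.$$ $\Omega(y_0)$ is the set of $(\gamma,\xi)\in\mathcal{P}(Y\times U)\times\mathcal{M}_+(Y\times U)$ with $\gamma\in W$ and $$\int_{Y\times U}(\phi(y_0)-\phi(y))\,\gamma(dy,du)+\int_{Y\times U}\nabla\phi(y)f(y,u)\,\xi(dy,du)=0\quad\forall\phi\in C^1,$$ and $k^*(y_0)=\inf_{(\gamma,\xi)\in\Omega(y_0)}\int_{Y\times U}k(y,u)\,\gamma(dy,du)$ (with $\inf\emptyset=+\infty$). Occupational measures. For $u\in\mathcal{U}_T(y_0)$ with trajectory $y(\cdot)$, $\gamma_{u,T}(Q)=\frac1T\int_0^T 1_Q(y(t),u(t))\,dt$ for Borel $Q\subset Y\times U$. For $u\in\mathcal{U}(y_0)$, $\gamma^\lambda_u(Q)=\lambda\int_0^\infty e^{-\lambda t}1_Q(y(t),u(t))\,dt$. $\Gamma_T$ is the set of all $\gamma_{u,T}$ with $y_0\in Y$, $u\in\mathcal{U}_T(y_0)$;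 $\Theta^\lambda$ is the set of all $\gamma_u^\lambda$ with $y_0\in Y$, $u\in\mathcal{U}(y_0)$; $\mathrm{co}$ denotes convex hull. Metric. $\rho(\gamma',\gamma'')=\sum_{j\ge1}2^{-j}\left|\int q_j\,d\gamma'-\int q_j\,d\gamma''\right|$ on $\mathcal{P}(Y\times U)$, where $(q_j)$ is a fixed sequence of Lipschitz functions dense in the unit ball of $C(Y\times U)$ (it metrizes weak$^*$ convergence); $\rho(\gamma,\Gamma)=\inf_{\gamma'\in\Gamma}\rho(\gamma,\gamma')$ and $\rho_H(\Gamma_1,\Gamma_2)=\max\{\sup_{\gamma\in\Gamma_1}\rho(\gamma,\Gamma_2),\sup_{\gamma\in\Gamma_2}\rho(\gamma,\Gamma_1)\}$. Enlarged problems. $Y^\delta=Y+\delta\bar B$ ($\bar B$ the closed unit ball). For $y_0\in Y^\delta$, $\mathcal{U}^\delta_T(y_0)$, $\mathcal{U}^\delta(y_0)$, $V^\delta_T(y_0)$, $h^\delta_\lambda(y_0)$ are defined exactly as $\mathcal{U}_T(y_0)$, $\mathcal{U}(y_0)$, $V_T(y_0)$, $h_\lambda(y_0)$ but with the constraint $y(t)\in Y^\delta$ instead of $y(t)\in Y$. Assumptions, for a given $\delta_0>0$: (A1) for all $\delta\in(0,\delta_0)$, $\mathcal{U}^\delta(y_0)\neq\emptyset$ for all $y_0\in Y^\delta$. (A2) for all $\delta\in(0,\delta_0)$ and $T>0$, $V^\delta_T(\cdot)$ is Lipschitz on $Y^\delta$. (A3) for all $\delta\in(0,\delta_0)$ and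 $\lambda>0$, $h^\delta_\lambda(\cdot)$ is Lipschitz on $Y^\delta$. (A4) for every $y_0\in Y$, $\lim_{T\to\infty,\ \delta\to0}|V_T(y_0)-V_T^\delta(y_0)|=0$ (joint limit). (A5) $\lim_{T\to\infty}\rho_H(\mathrm{co}\,\Gamma_T,W)=0$. (A6) for every $y_0\in Y$, $\lim_{\lambda\downarrow0,\ \delta\to0}|h_\lambda(y_0)-h_\lambda^\delta(y_0)|=0$ (joint limit). (A7) $\lim_{\lambda\downarrow0}\rho_H(\mathrm{co}\,\Theta^\lambda,W)=0$. *)

(* Defs.v *)
From HB Require Import structures.
From mathcomp Require Import all_boot all_order all_algebra.
From mathcomp Require Import all_classical all_reals all_analysis.

Set Implicit Arguments.
Unset Strict Implicit.
Unset Printing Implicit Defensive.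

Import Order.TTheory GRing.Theory Num.Theory.
Import numFieldNormedType.Exports.

Local Open Scope classical_set_scope.
Local Open Scope ring_scope.

(* Metric spaces with a base point: the library puts sigma-algebras on pointed
   types only.  For the control set this just says that it is nonempty, which
   viability on a nonempty state constraint set forces anyway. *)
#[short(type="pmetricType")]
HB.structure Definition PointedMetric (K : numDomainType) :=
  { M of Metric K M & Pointed M }.

Notation borelType T := (g_sigma_algebraType (@open T%type)).

Section control_system.
Context {R : realType} {m : nat} {U : pmetricType R}.
Local Notation state := 'rV[R]_m.
Local Notation stateU := ('rV[R]_m * U)%type.
Local Notation leb := (@lebesgue_measure R).
Local Notation process := ((R -> U) * (R -> state))%type.

Implicit Types (f : state -> U -> state) (k : state -> U -> R)
  (Y Z : set state) (y : state) (T lambda delta : R) (p : process)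
  (phi : state -> R) (q : nat -> stateU -> R).

(* Controls and trajectories are functions on R of which only the values on
   [0, +oo[ matter. *)
Definition measurable_control (u : R -> U) : Prop :=
  @measurable_fun _ _ (measurableTypeR R) (borelType U) `[0, +oo[ u.

(* Caratheodory solutions of y' = f(y, u), y(0) = y0, in integral form. *)
Definition solution f y0 (u : R -> U) (y : R -> state) : Prop :=
  {within `[0, +oo[, continuous y} /\
  forall t, 0 <= t ->
    y t = y0 + \row_i \int[leb]_(s in `[0, t]) (f (y s) (u s) 0 i).

(* Admissible controls, each paired with the trajectory it generates (unique
   on [0, +oo[ when f is Lipschitz in y): p.1 is the control u and p.2 is
   y(., y0, u).  The constraint set Z is Y or one of its enlargements. *)
Definition admissible_on (I : set R) f Z y0 : set process :=
  [set p | [/\ measurable_control p.1, solution f y0 p.1 p.2 &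
               forall t, I t -> Z (p.2 t)]].

Definition admissible_fin f Z T y0 := admissible_on `[0, T] f Z y0.

Definition admissible_inf f Z y0 := admissible_on `[0, +oo[ f Z y0.

Definition viable f Z : Prop :=
  forall y0, Z y0 -> admissible_inf f Z y0 !=set0.

Definition V_opt f k Z T y0 : \bar R :=
  ((T^-1)%:E * ereal_inf
    [set \int[leb]_(t in `[0%R, T]) (k (p.2 t) (p.1 t))%:E
      | p in admissible_fin f Z T y0])%E.

Definition h_opt f k Z lambda y0 : \bar R :=
  (lambda%:E * ereal_inf
    [set \int[leb]_(t in `[0%R, +oo[)
           (expR (- lambda * t) * k (p.2 t) (p.1 t))%:E
      | p in admissible_inf f Z y0])%E.

Definition grad phi (y : state) : state := \row_i 'D_(delta_mx 0 i) phi y.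

Definition C1 phi : Prop :=
  (forall y, differentiable phi y) /\ continuous (grad phi).

(* grad phi (y) f(y, u) *)
Definition grad_dot f phi (x : stateU) : R :=
  \sum_i grad phi x.1 0 i * f x.1 x.2 0 i.

(* Borel measures on Y x U are represented by the Borel measures on
   R^m x U that give no mass to the complement of Y x U. *)
Definition YU Y : set (borelType stateU) := Y `*` [set: U].

Definition carried_by Y (nu : set (borelType stateU) -> \bar R) : Prop :=
  nu (~` YU Y) = 0%E.

Definition W_set f Y : set (probability (borelType stateU) R) :=
  [set gamma | carried_by Y gamma /\
    forall phi, C1 phi ->
      (\int[gamma]_(x in YU Y) (grad_dot f phi x)%:E = 0)%E].

Definition Omega f Y y0 : set (probability (borelType stateU) R *
    {finite_measure set (borelType stateU) -> \bar R}) :=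
  [set gx : probability (borelType stateU) R *
            {finite_measure set (borelType stateU) -> \bar R} |
   [/\ W_set f Y gx.1, carried_by Y gx.2 &
    forall phi, C1 phi ->
      (\int[gx.1]_(x in YU Y) (phi y0 - phi x.1)%:E
       + \int[gx.2]_(x in YU Y) (grad_dot f phi x)%:E = 0)%E]].

Definition kstar f k Y y0 : \bar R :=
  ereal_inf [set (\int[gx.1]_(x in YU Y) (k x.1 x.2)%:E)%E
    | gx in Omega f Y y0].

Definition occ_fin T p (Q : set (borelType stateU)) : \bar R :=
  ((T^-1)%:E * \int[leb]_(t in `[0%R, T]) (\1_Q (p.2 t, p.1 t))%:E)%E.

Definition occ_inf lambda p (Q : set (borelType stateU)) : \bar R :=
  (lambda%:E * \int[leb]_(t in `[0%R, +oo[)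
    (expR (- lambda * t) * \1_Q (p.2 t, p.1 t))%:E)%E.

Definition Gamma f Y T : set (probability (borelType stateU) R) :=
  [set gamma | exists y0 p, [/\ Y y0, admissible_fin f Y T y0 p &
    forall Q, measurable Q -> gamma Q = occ_fin T p Q]].

Definition Theta f Y lambda : set (probability (borelType stateU) R) :=
  [set gamma | exists y0 p, [/\ Y y0, admissible_inf f Y y0 p &
    forall Q, measurable Q -> gamma Q = occ_inf lambda p Q]].

Definition conv_hull (G : set (probability (borelType stateU) R)) :
    set (probability (borelType stateU) R) :=
  [set gamma | exists n (w : 'I_n -> R)
      (g : 'I_n -> probability (borelType stateU) R),
    [/\ forall i, 0 <= w i, \sum_i w i = 1, forall i, G (g i) &
        forall Q, measurable Q ->
          gamma Q = (\sum_i (w i)%:E * g i Q)%E]].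

(* q is a sequence of Lipschitz functions on Y x U that lies, and is dense, in
   the unit ball of C(Y x U); only the values on Y x U matter. *)
Definition dense_lipschitz_seq Y q : Prop :=
  [/\ forall j, exists L : R, forall y y' (u u' : U), Y y -> Y y' ->
        `|q j (y, u) - q j (y', u')| <= L * (`|y - y'| + mdist u u'),
      forall j x, (Y `*` [set: U]) x -> `|q j x| <= 1 &
      forall g : stateU -> R, {within Y `*` [set: U], continuous g} ->
        (forall x, (Y `*` [set: U]) x -> `|g x| <= 1) ->
        forall e : R, 0 < e ->
          exists j, forall x, (Y `*` [set: U]) x -> `|q j x - g x| < e].

(* The sequence is indexed from 0, hence the weights 2^-(j+1). *)
Definition rho Y q (g1 g2 : probability (borelType stateU) R) : \bar R :=
  (\sum_(0 <= j <oo)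
     (2^-1 ^+ j.+1 * `|\int[g1]_(x in YU Y) (q j x)
                       - \int[g2]_(x in YU Y) (q j x)|)%R%:E)%E.

Definition rho_set Y q (g : probability (borelType stateU) R)
    (G : set (probability (borelType stateU) R)) : \bar R :=
  ereal_inf [set rho Y q g g' | g' in G].

Definition rho_H Y q (G1 G2 : set (probability (borelType stateU) R)) : \bar R :=
  Order.max (ereal_sup [set rho_set Y q g G2 | g in G1])
            (ereal_sup [set rho_set Y q g G1 | g in G2]).

(* The ball is the Euclidean one, whereas the norm of 'rV[R]_m in the library
   is the supremum norm. *)
Definition euclidean_closed_unit_ball : set state :=
  [set b | \sum_i b 0 i ^+ 2 <= 1].

Definition enlarge Y delta : set state :=
  [set y + delta *: b | y in Y & b in euclidean_closed_unit_ball].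

Definition ereal_lipschitz (A : set state) (v : state -> \bar R) : Prop :=
  (forall y, A y -> v y \is a fin_num) /\ [lipschitz fine (v y) | y in A].

Definition A1 f Y delta0 : Prop :=
  forall delta, 0 < delta < delta0 -> viable f (enlarge Y delta).

Definition A2 f k Y delta0 : Prop :=
  forall delta T, 0 < delta < delta0 -> 0 < T ->
    ereal_lipschitz (enlarge Y delta) (V_opt f k (enlarge Y delta) T).

Definition A3 f k Y delta0 : Prop :=
  forall delta lambda, 0 < delta < delta0 -> 0 < lambda ->
    ereal_lipschitz (enlarge Y delta) (h_opt f k (enlarge Y delta) lambda).

Definition A4 f k Y : Prop :=
  forall y0, Y y0 ->
    (`|V_opt f k Y Td.1 y0 - V_opt f k (enlarge Y Td.2) Td.1 y0|)%E
      @[Td --> filter_prod (+oo : set_system R) (0 : R)^'+] --> 0%E.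

Definition A5 f Y q : Prop :=
  rho_H Y q (conv_hull (Gamma f Y T)) (W_set f Y) @[T --> +oo] --> 0%E.

Definition A6 f k Y : Prop :=
  forall y0, Y y0 ->
    (`|h_opt f k Y ld.1 y0 - h_opt f k (enlarge Y ld.2) ld.1 y0|)%E
      @[ld --> filter_prod (0 : R)^'+ (0 : R)^'+] --> 0%E.

Definition A7 f Y q : Prop :=
  rho_H Y q (conv_hull (Theta f Y lambda)) (W_set f Y)
    @[lambda --> (0 : R)^'+] --> 0%E.

End control_system.

(* Main.v *)
Require Import Defs.
From HB Require Import structures.
From mathcomp Require Import all_boot all_order all_algebra.
From mathcomp Require Import all_classical all_reals all_analysis.
From mathcomp Require Import measurable_realfun.
From mathcomp Require Import ring lra.
Import Order.TTheory GRing.Theory Num.Theory.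
Import numFieldNormedType.Exports.
Local Open Scope classical_set_scope.
Local Open Scope ring_scope.

Set Implicit Arguments.
Unset Strict Implicit.
Unset Printing Implicit Defensive.

(** Both optimal values are averages of the running cost against a probability
    law on the half-line: the uniform law on [0, T], or the exponential law of
    rate lambda. Put c = 1 / T, respectively c = lambda. Translating the time by
    tau changes such an average of a function bounded by M by at most 2 M c tau.

    Let v be the value of the problem enlarged by a fixed delta. Dynamic
    programming with a control that is constant on a short interval gives
    v (y) <= v (y + tau f(y, u)) + 2 M c tau + O(tau^2) near Y, for all u. As v is
    Lipschitz, mollification turns this into C^1 functions phi, uniformly close
    to v on Y, with grad phi . f >= - 2 M c - e on Y x U. Testing the second
    equation of Omega(y0) with phi yields, as e tends to 0,
    v (y0) <= int v dgamma + 2 M c xi(Y x U).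

    Since gamma is in W, it is a limit of convex combinations of occupational
    measures, that is, of averages along trajectories against ever slower laws.
    Along a trajectory v is at most the average of the future cost; exchanging
    the two averages, this gives int v dgamma <= int k dgamma. Hence
    v (y0) <= int k dgamma + 2 M c xi(Y x U), one lets c tend to 0, and
    (A4) or (A6) brings v back to the value of the original problem. *)

(** * Slowly varying averages in time *)

(** The state constraint is the obstacle: near the boundary of [Y] neither a frozen control nor a
    mollifier stays in [Y]. In the enlargement every point of [Y] has a ball of fixed radius, so
    short arcs and small averages remain inside, while trajectories in [Y] stay admissible; hence it
    is the enlarged value that is tested against both [gamma] and [xi].

    The Lipschitz constant [K] of this value may grow without control as [c] tends to 0. It only
    multiplies the mollification scale [e], which is sent to 0 while [c] and delta are fixed, so [K]
    has disappeared before [c] moves. In the same spirit, the laws along trajectories are slowed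
    down while the law that defines [v] is kept fixed.

    Nothing distinguishes (a) from (b) once two properties of the law are isolated: no mass at
    negative times, and domination by its translates up to [c] times Lebesgue measure. Both parts
    are therefore instances of one inequality. *)

Lemma integral_density d (T : measurableType d) (R : realType)
    (mu : {sigma_finite_measure set T -> \bar R})
    (nu : {finite_measure set T -> \bar R}) (g : T -> R) (h : T -> \bar R) :
  mu.-integrable setT (EFin \o g) ->
  (forall A, measurable A -> nu A = (\int[mu]_(x in A) (g x)%:E)%E) ->
  nu.-integrable setT h ->
  (\int[nu]_x h x = \int[mu]_x (h x * (g x)%:E))%E.
Proof.
move=> ig nug ih.
have numu : nu `<< mu.
  apply/null_content_dominatesP => A mA muA0.
  rewrite nug// null_set_integral//.
  exact: measurable_funS (measurable_int _ ig).
rewrite -(Radon_Nikodym_change_of_variables numu)//.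
have mh := measurable_int _ ih; have mg := measurable_int _ ig.
have iRN : mu.-integrable setT (Radon_Nikodym (charge_of_finite_measure nu) mu).
  exact: Radon_Nikodym_integrable.
have mRN := measurable_int _ iRN.
apply: ae_eq_integral => //; [exact: emeasurable_funM..|].
(* [g] and the Radon-Nikodym derivative have the same integral over every measurable set, hence
   agree almost everywhere. *)
apply: ae_eqe_mul2l; apply: integral_ae_eq => //.
by move=> E _ mE; rewrite -Radon_Nikodym_integral//; exact: nug.
Qed.

Lemma bounded_integrable d (T : measurableType d) (R : realType)
    (P : {finite_measure set T -> \bar R}) (h : T -> R) (M : R) :
  measurable_fun setT h -> (forall x, `|h x| <= M) ->
  P.-integrable setT (EFin \o h).
Proof.
move=> mh hM; apply: measurable_bounded_integrable => //.
  by rewrite -ge0_fin_numE// fin_num_measure.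
exists M; split; first exact: num_real.
by move=> x Mx y _; exact: le_trans (hM y) (ltW Mx).
Qed.

Lemma EFin_Rintegral d (T : measurableType d) (R : realType)
    (mu : {measure set T -> \bar R}) (D : set T) (h : T -> R) :
  measurable D -> mu.-integrable D (EFin \o h) ->
  (\int[mu]_(x in D) h x)%:E = (\int[mu]_(x in D) (h x)%:E)%E.
Proof. by move=> mD ih; rewrite fineK//; exact: integrable_fin_num. Qed.

Section averaging.
Context {R : realType}.
Local Notation RR := (measurableTypeR R).
Local Notation leb := (@lebesgue_measure R).

Lemma lebesgue_measure_translation (a : R) (A : set RR) : measurable A ->
  leb ((fun x => x + a) @^-1` A) = leb A.
Proof.
move=> mA.
have ma : measurable_fun [set: RR] (fun x : RR => x + a : RR) by exact: measurable_funD.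
pose f_mixin := isMeasurableFun.Build _ _ _ _ _ ma.
pose f : {mfun RR >-> RR} := HB.pack (fun x : RR => x + a : RR) f_mixin.
rewrite [RHS](@lebesgue_measure_unique _ (pushforward leb f))// => X [[b c] /= bc <-].
rewrite /pushforward (_ : f @^-1` _ = `](b - a), (c - a)]%classic); last first.
  by apply/seteqP; split => x /=; rewrite !in_itv/= ltrBlDr lerBrDr.
by rewrite !lebesgue_measure_itv/= !lte_fin ltrD2r -!EFinB opprB addrA subrK.
Qed.

(* The shift inequality dominates P by its translate up to a measure of mass at
   most c tau; it holds for the uniform law on [0, T] with c = 1 / T and for the
   exponential law of rate c. *)
Definition averaging (c : R) (P : probability RR R) : Prop :=
  P `]-oo, 0[%classic = 0%E /\
  forall tau, 0 <= tau -> forall A : set RR, measurable A ->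
    (P A <= P ((fun x => (x + tau)%R) @^-1` A) + c%:E * leb (A `&` `[0%R, tau]))%E.

(** Adding [M] makes [h] nonnegative, so the domination of [P] by its translate plus [c] times
    Lebesgue measure on [0, tau] passes to integrals. The second measure has mass [c * tau] and
    meets an integrand of at most [2 * M]. *)
Lemma averaging_shift_le c (P : probability RR R) (h : RR -> R) (M tau : R) :
  averaging c P -> 0 <= c -> 0 <= tau -> measurable_fun setT h ->
  (forall x, `|h x| <= M) ->
  \int[P]_x h x <= \int[P]_x h (x + tau) + 2 * M * c * tau.
Proof.
move=> [_ Pc] c0 tau0 mh hM.
have M0 : 0 <= M by rewrite (le_trans _ (hM 0)).
have mt : measurable_fun [set: RR] (fun x : RR => x + tau : RR) by exact: measurable_funD.
have mht : measurable_fun [set: RR] (fun x : RR => h (x + tau)) by exact: measurableT_comp.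
pose f_mixin := isMeasurableFun.Build _ _ _ _ _ mt.
pose f : {mfun RR >-> RR} := HB.pack (fun x : RR => x + tau : RR) f_mixin.
have mI : measurable (`[0%R, tau]%classic : set RR) by exact: measurable_itv.
pose nu := mscale (NngNum c0) (mrestr leb mI).
have hM0 x : 0 <= h x + M by rewrite -lerBlDr sub0r; have := hM x; rewrite ler_norml => /andP[].
have mhM : measurable_fun [set: RR] (fun x => (h x + M)%:E).
  by apply/measurable_EFinP; exact: measurable_funD.
have : (\int[P]_x (h x + M)%:E <= \int[measure_add (distribution P f) nu]_x (h x + M)%:E)%E.
  apply: ge0_le_measure_integral => // A mA.
  have QE := measure_addE (distribution P f) nu A. 
  apply: (le_trans (Pc _ tau0 _ mA)); rewrite le_eqVlt; apply/orP; left.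
  by apply/eqP; exact: esym QE.
have hMle x : h x + M <= 2 * M.
  by have := hM x; rewrite ler_norml => /andP[_]; lra.
have ih : P.-integrable setT (EFin \o h) by exact: bounded_integrable hM.
have iht : P.-integrable setT (EFin \o (fun x => h (x + tau))).
  by apply: (@bounded_integrable _ _ _ _ _ M).
rewrite ge0_integral_measure_add//; last by move=> x _; rewrite lee_fin.
rewrite ge0_integral_distribution//= => PQ.
have : (\int[nu]_x (h x + M)%:E <= (2 * M * c * tau)%:E)%E.
  apply: (@le_trans _ _ (\int[nu]_x (2 * M)%:E)%E).
    apply: ge0_le_integral => //.
    by move=> x _; rewrite lee_fin.
    by move=> x _; rewrite lee_fin.
  rewrite integral_cst//= /mscale/= /mrestr setTI lebesgue_measure_itv/= lte_fin.
  case: ltgtP tau0 => // [t0 _|<- _]; first by rewrite -EFinB subr0 -!EFinM lee_fin; lra.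
  by rewrite !mule0 mulr0.
move=> /(leeD2l _) /(le_trans PQ).
have iM : P.-integrable setT (EFin \o cst M) by exact: finite_measure_integrable_cst.
under eq_integral do rewrite EFinD.
under [X in (_ <= X + _)%E]eq_integral do rewrite EFinD.
rewrite !integralD//.
rewrite -!EFin_Rintegral// -!EFinD lee_fin; lra.
Qed.

Lemma averaging_shift c (P : probability RR R) (h : RR -> R) (M tau : R) :
  averaging c P -> 0 <= c -> 0 <= tau -> measurable_fun setT h ->
  (forall x, `|h x| <= M) ->
  `|\int[P]_x h (x + tau) - \int[P]_x h x| <= 2 * M * c * tau.
Proof.
move=> Pc c0 tau0 mh hM.
have mt : measurable_fun [set: RR] (fun x : RR => x + tau : RR) by exact: measurable_funD.
have ih : P.-integrable setT (EFin \o h) by exact: bounded_integrable hM.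
have iht : P.-integrable setT (EFin \o (fun x => h (x + tau))).
  by apply: (@bounded_integrable _ _ _ _ _ M) => //; exact: measurableT_comp.
have mhN : measurable_fun setT (fun x => - h x) by exact: measurableT_comp.
have H1 := averaging_shift_le Pc c0 tau0 mh hM.
have hNM x : `|- h x| <= M by rewrite normrN.
have := averaging_shift_le Pc c0 tau0 mhN hNM.
have N1 (g : RR -> R) : P.-integrable setT (EFin \o g) ->
    \int[P]_x (- g x) = - \int[P]_x g x.
  by move=> ig; rewrite -mulN1r -RintegralZl//; apply: eq_Rintegral => x _; rewrite mulN1r.
by rewrite !N1// ler_norml => H2; apply/andP; split; lra.
Qed.

End averaging.

(** * The uniform and exponential laws *)

Section averaging_examples.
Context {R : realType}.
Local Notation RR := (measurableTypeR R).
Local Notation leb := (@lebesgue_measure R).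

Lemma uniform_probE (T : R) (T0 : 0 < T) (A : set RR) : measurable A ->
  uniform_prob T0 A = ((T^-1)%:E * leb (A `&` `[0%R, T]))%E.
Proof.
move=> mA; rewrite /uniform_prob integral_uniform_pdf.
rewrite (eq_integral (cst (T^-1)%:E)); last first.
  by move=> x; rewrite inE/= in_itv/= /uniform_pdf subr0 => -[_ ->].
by rewrite integral_cst//; exact: measurableI.
Qed.

Lemma averaging_uniform (T : R) (T0 : 0 < T) :
  averaging T^-1 (uniform_prob T0).
Proof.
split => [|tau tau0 A mA].
  rewrite /= uniform_probE// (_ : _ `&` _ = set0) ?measure0 ?mule0//.
  by apply/seteqP; split => x //=; rewrite !in_itv/=; lra.
have mtau : measurable ((fun x : RR => x + tau : RR) @^-1` A).
  rewrite -[X in measurable X]setTI; apply: (measurable_funD _ _ _ mA) => //.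
rewrite /= !uniform_probE// -muleDr//; last by rewrite ge0_adde_def// inE.
rewrite lee_pmul2l//; last by rewrite lte_fin invr_gt0.
(* [B] is the translate by [tau] of the set measured by the first term on the right. It covers the
   part of [A] in [0, T] beyond [tau]; the second term covers the rest. *)
pose B := A `&` `[tau, T + tau]%classic.
have -> : (fun x => x + tau) @^-1` A `&` `[0, T] = (fun x : RR => x + tau) @^-1` B.
  apply/seteqP; split => x /=; rewrite /B/= !in_itv/=.
    by move=> [? ?]; split => //; lra.
  by move=> [? ?]; split => //; lra.
have mB : measurable B by exact: measurableI.
rewrite [X in (_ <= X + _)%E]lebesgue_measure_translation//.
apply: le_trans (measureU2 leb _ _) => //; last exact: measurableI.
apply: le_measure; rewrite ?inE//; [exact: measurableI| |].
  by apply: measurableU => //; exact: measurableI.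
move=> x /=; rewrite /B/= !in_itv/= => -[Ax xT].
have [xt|xt] := leP x tau; [right|left]; split => //; lra.
Qed.

Lemma integral_lebesgue_translation (a : R) (A : set RR) (g : RR -> \bar R) :
  measurable A -> measurable_fun setT g -> (forall x, 0 <= g x)%E ->
  (\int[leb]_(x in (fun x => (x + a)%R) @^-1` A) g (x + a)%R = \int[leb]_(x in A) g x)%E.
Proof.
move=> mA mg g0.
have ma : measurable_fun [set: RR] (fun x : RR => x + a : RR) by exact: measurable_funD.
rewrite -(@ge0_integral_pushforward _ _ _ _ _ _ ma leb _ g)//; last exact: measurable_funTS.
apply: eq_measure_integral => B mB BA.
exact: lebesgue_measure_translation.
Qed.

Definition exponential_probability (rate : R) (rate0 : 0 < rate) :
  probability RR R.
Proof. by refine (exponential_prob rate). Defined.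

Lemma exponential_pdf_ge0E (c x : R) : 0 <= x ->
  exponential_pdf c x = c * expR (- c * x).
Proof. exact: exponential_pdfE. Qed.

(** On [0, tau] the density is at most [c]; beyond [tau] it is decreasing, hence below its
    translate. *)
Lemma exponential_pdf_shift_le (c tau x : R) : 0 < c -> 0 <= tau ->
  exponential_pdf c x <= exponential_pdf c (x - tau) + c * \1_(`[0, tau]%classic) x.
Proof.
move=> c0 tau0.
have p0 y : 0 <= exponential_pdf c y by rewrite exponential_pdf_ge0 // ltW.
have [x0|x0] := ltP x 0.
  rewrite [leLHS]lt0_exponential_pdf//.
  by rewrite addr_ge0// mulr_ge0// ltW.
rewrite indicE; have [xt|xt] := leP x tau.
  rewrite mem_set/= ?in_itv/= ?x0// mulr1 [leLHS]exponential_pdf_ge0E//.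
  apply: (@le_trans _ _ c); last by rewrite lerDr.
  by rewrite ger_pMr// -expR0 ler_expR; nra.
rewrite memNset/= ?in_itv/= ?x0 ?(lt_geF xt)// mulr0 addr0.
rewrite !exponential_pdf_ge0E//; last lra.
by rewrite ler_pM2l// ler_expR; nra.
Qed.

Lemma averaging_exponential (c : R) (c0 : 0 < c) :
  averaging c (exponential_probability c0).
Proof.
have p0 y : 0 <= exponential_pdf c y by rewrite exponential_pdf_ge0 // ltW.
have mp := @measurable_exponential_pdf R c.
split => [|tau tau0 A mA] /=; rewrite /exponential_prob.
  by apply: integral0_eq => x /=; rewrite in_itv/= => x0; rewrite lt0_exponential_pdf.
have mpt : measurable_fun [set: RR] (fun x : RR => exponential_pdf c (x - tau)).
  by apply: (measurableT_comp mp); exact: measurable_funB.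
have -> : (\int[leb]_(x in (fun x => (x + tau)%R) @^-1` A) (exponential_pdf c x)%:E =
    \int[leb]_(x in A) (exponential_pdf c (x - tau))%:E)%E.
  rewrite -(@integral_lebesgue_translation tau A
    (fun x => (exponential_pdf c (x - tau))%:E))//; last 2 first.
  exact/measurable_EFinP.
  by move=> x; rewrite lee_fin.
  by apply: eq_integral => x _; rewrite addrK.
have -> : (c%:E * leb (A `&` `[0%R, tau]) =
    \int[leb]_(x in A) (c * \1_(`[0, tau]%classic) x)%:E)%E.
  under eq_integral do rewrite EFinM.
  rewrite integralZl//.
    by rewrite integral_indic// setIC.
  apply: (integrableS measurableT) => //; apply/integrableP; split.
    by apply/measurable_EFinP; exact: measurable_indic.
  under eq_integral do rewrite gee0_abs ?lee_fin//.
  rewrite integral_indic// setIT /= lebesgue_measure_itv/= lte_fin.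
  by case: ifP => _; rewrite ?ltry.
rewrite -ge0_integralD//; last 4 first.
- by move=> x _; rewrite lee_fin.
- exact/measurable_EFinP/measurable_funTS.
- by move=> x _; rewrite lee_fin mulr_ge0// ltW.
- by apply/measurable_EFinP/measurable_funM => //; exact/measurable_funTS/measurable_indic.
apply: ge0_le_integral => //.
- by move=> x _; rewrite lee_fin.
- exact/measurable_EFinP/measurable_funTS.
- apply: emeasurable_funD; apply/measurable_EFinP; first exact/measurable_funTS.
  by apply/measurable_funM => //; exact/measurable_funTS/measurable_indic.
- by move=> x _; rewrite -EFinD lee_fin exponential_pdf_shift_le.
Qed.

(** With [mean_exponential], this brings the normalised costs in [V_opt] and [h_opt] to the common
    form of an integral against a probability. *)
Lemma mean_uniform (T : R) (T0 : 0 < T) (h : RR -> R) (M : R) :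
  measurable_fun setT h -> (forall x, `|h x| <= M) ->
  (T^-1%:E * \int[leb]_(t in `[0%R, T]) (h t)%:E)%E =
  (\int[uniform_prob T0]_t h t)%:E.
Proof.
move=> mh hM.
have ih := bounded_integrable (uniform_prob T0) mh hM.
rewrite EFin_Rintegral//.
rewrite (@integral_density _ _ _ leb _ (uniform_pdf 0 T))//; last first.
  exact: integrable_uniform_pdf.
rewrite -integralZl//; last first.
  apply: measurable_bounded_integrable => //.
  - by rewrite /= lebesgue_measure_itv/= lte_fin T0 ltry.
  - exact: measurable_funTS.
  - exists M; split; first exact: num_real.
    by move=> x Mx y _; exact: le_trans (hM y) (ltW Mx).
rewrite integral_mkcond; apply: eq_integral => x _.
rewrite patchE /uniform_pdf mem_setE/= in_itv/= subr0.
by case: ifP => _; rewrite ?mule0 // muleC.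
Qed.

Lemma mean_exponential (c : R) (c0 : 0 < c) (h : RR -> R) (M : R) :
  measurable_fun setT h -> (forall x, `|h x| <= M) ->
  (c%:E * \int[leb]_(t in `[0%R, +oo[) (expR (- c * t) * h t)%:E)%E =
  (\int[exponential_probability c0]_t h t)%:E.
Proof.
move=> mh hM.
have p0 y : 0 <= exponential_pdf c y by rewrite exponential_pdf_ge0 // ltW.
have ih := bounded_integrable (exponential_probability c0) mh hM.
rewrite EFin_Rintegral//.
have ip := integrable_exponential_pdf c0.
have ih' : leb.-integrable setT (fun x => (h x * exponential_pdf c x)%:E).
  apply: (@le_integrable _ _ _ leb setT measurableT _ (fun x => M%:E * (exponential_pdf c x)%:E)%E).
  - apply/measurable_EFinP/measurable_funM => //.
    exact: measurable_exponential_pdf.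
  - move=> x _; rewrite -EFinM !abse_EFin lee_fin !normrM ler_wpM2r//.
    by rewrite (le_trans (hM x)) ?ler_norm.
  - exact: integrableZl.
rewrite (@integral_density _ _ _ leb _ (exponential_pdf c))//.
rewrite -integralZl//; last first.
  apply: (@le_integrable _ _ _ leb _ _ _ (fun x => c^-1%:E * (h x * exponential_pdf c x)%:E)%E) => //.
  - apply/measurable_EFinP/measurable_funM; last exact/measurable_funTS.
    apply: measurable_funTS; apply: measurableT_comp; first exact: measurable_expR.
    exact: measurable_funM.
  - move=> x; rewrite /= in_itv/= andbT => x0.
    rewrite exponential_pdf_ge0E// lee_fin.
    by rewrite [h x * _]mulrCA mulKf ?gt_eqF// mulrC.
  - apply: integrableZl => //.
    exact: (integrableS measurableT).
rewrite integral_mkcond; apply: eq_integral => x _.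
rewrite patchE mem_setE/= in_itv/= andbT.
have [x0|x0] := leP 0 x; last by rewrite lt0_exponential_pdf// mule0.
by rewrite exponential_pdf_ge0E// -!EFinM; congr (_%:E); ring.
Qed.

End averaging_examples.

(** * Mollification of Lipschitz functions *)

Lemma lipschitz_continuous (R : realType) (V W : normedModType R) (h : V -> W) (K : R) :
  (forall x y, `|h x - h y| <= K * `|x - y|) -> continuous h.
Proof.
move=> hK x; apply/cvgrPdist_lt => e e0.
have K1 : 0 < `|K| + 1 by rewrite ltr_pwDr.
near=> y; apply: le_lt_trans (hK _ _) _.
apply: (@le_lt_trans _ _ ((`|K| + 1) * `|x - y|)).
  by rewrite ler_wpM2r// (le_trans (ler_norm _))// lerDl.
rewrite mulrC -ltr_pdivlMr//; near: y.
by apply: cvgr_dist_lt; [exact: cvg_id|exact: divr_gt0].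
Unshelve. all: by end_near. Qed.

Section interval_mean.
Context {R : realType}.
Local Notation leb := (@lebesgue_measure R).
Implicit Types (g h : R -> R).

(** The primitive starts at [- N], so that negative points too are interior to its domain;
    [imean_translation] needs them when [a < 0]. *)
Lemma exists_antiderivative g (N : R) : continuous g ->
  exists G : R -> R, forall x, - N < x < N -> is_derive x 1 G (g x).
Proof.
move=> cg; exists (fun x => \int[leb]_(t in `[(- N), x]) g t) => x /andP[Nx xN].
have ig : leb.-integrable `[(- N), N] (EFin \o g).
  apply: continuous_compact_integrable; first exact: segment_compact.
  exact: continuous_subspaceT.
have [dF <-] := continuous_FTC1_closed xN ig Nx (cg x).
by rewrite derive1E; exact: derivableP.
Qed.

Lemma derive_integral_segment g G (a b : R) : a < b -> continuous g ->
  (forall x, a <= x <= b -> is_derive x 1 G (g x)) ->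
  \int[leb]_(t in `[a, b]) g t = G b - G a.
Proof.
move=> ab cg dG; rewrite /Rintegral (@continuous_FTC2 _ g G)//.
- exact: continuous_subspaceT.
- have cG x : a <= x <= b -> {for x, continuous G}.
    move=> /dG dGx; apply: differentiable_continuous.
    by apply/derivable1_diffP; exact: ex_derive.
  split.
  + move=> x; rewrite in_itv/= => /andP[ax xb].
    by have := dG x; rewrite !ltW// => /(_ isT) ?; exact: ex_derive.
  + by apply: cvg_at_right_filter; apply: cG; rewrite lexx ltW.
  + by apply: cvg_at_left_filter; apply: cG; rewrite lexx ltW.
- move=> x; rewrite in_itv/= => /andP[ax xb].
  by have := dG x; rewrite !ltW// => /(_ isT) ?; rewrite derive1E derive_val.
Qed.

Definition imean (eta : R) h : R := eta^-1 * \int[leb]_(t in `[0, eta]) h t.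

Variable eta : R.
Hypothesis eta0 : 0 < eta.

Lemma integrable_segment h (a b : R) : continuous h ->
  leb.-integrable `[a, b] (EFin \o h).
Proof.
move=> ch; apply: continuous_compact_integrable; first exact: segment_compact.
exact: continuous_subspaceT.
Qed.

Lemma imean_cst (c : R) : imean eta (cst c) = c.
Proof.
rewrite /imean Rintegral_cst//= lebesgue_measure_itv/= lte_fin eta0/= subr0.
by rewrite mulrCA mulVf ?mulr1// gt_eqF.
Qed.

Lemma imeanB g h : continuous g -> continuous h ->
  imean eta (fun s => g s - h s) = imean eta g - imean eta h.
Proof.
move=> cg ch; rewrite /imean RintegralB//; [|exact: integrable_segment..].
by rewrite mulrBr.
Qed.

Lemma imeanZ (c : R) h : continuous h ->
  imean eta (fun s => c * h s) = c * imean eta h.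
Proof.
by move=> ch; rewrite /imean RintegralZl//; [rewrite mulrCA|exact: integrable_segment].
Qed.

Lemma imeanD g h : continuous g -> continuous h ->
  imean eta (fun s => g s + h s) = imean eta g + imean eta h.
Proof.
move=> cg ch; rewrite /imean RintegralD//; [|exact: integrable_segment..].
by rewrite mulrDr.
Qed.

Lemma imean_sum (I : Type) (r : seq I) (F : I -> R -> R) :
  (forall i, continuous (F i)) ->
  continuous (fun s => \sum_(i <- r) F i s) /\
  imean eta (fun s => \sum_(i <- r) F i s) = \sum_(i <- r) imean eta (F i).
Proof.
move=> cF; elim: r => [|i r [ch ihr]].
  under eq_fun do rewrite big_nil.
  by split; [move=> s; exact: cvg_cst|rewrite big_nil imean_cst].
under eq_fun do rewrite big_cons.
split; first by move=> s; apply: cvgD; [exact: cF|exact: ch].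
by rewrite big_cons -ihr imeanD.
Qed.

Lemma le_imean g h : continuous g -> continuous h ->
  (forall s, 0 <= s <= eta -> g s <= h s) -> imean eta g <= imean eta h.
Proof.
move=> cg ch gh; rewrite /imean ler_pM2l ?invr_gt0//.
by apply: le_Rintegral => //; exact: integrable_segment.
Qed.

Lemma imean_dist_le g h (c : R) : continuous g -> continuous h ->
  (forall s, 0 <= s <= eta -> `|g s - h s| <= c) ->
  `|imean eta g - imean eta h| <= c.
Proof.
move=> cg ch gh; rewrite -imeanB//.
have cgh : continuous (fun s => g s - h s).
  by move=> s; apply: cvgB; [exact: cg|exact: ch].
have cc (d : R) : continuous (cst d : R -> R) by move=> s; exact: cvg_cst.
rewrite ler_norml; apply/andP; split.
  rewrite -[leLHS]imean_cst; apply: le_imean => // s /gh.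
  by rewrite ler_norml => /andP[].
rewrite -[leRHS]imean_cst; apply: le_imean => // s /gh.
by rewrite ler_norml => /andP[].
Qed.

(* Differentiating a |-> G (eta + a) - G a, where G is an antiderivative of h. *)
Lemma imean_translation h (K a : R) :
  (forall x y, `|h x - h y| <= K * `|x - y|) ->
  `|imean eta (fun s => h (s + a)) - imean eta h - a / eta * (h eta - h 0)|
    <= 2 * K / eta * a ^+ 2.
Proof.
move=> hK.
have K0 : 0 <= K by have := le_trans (normr_ge0 _) (hK 1 0); rewrite subr0 normr1 mulr1.
have ch : continuous h := @lipschitz_continuous R R^o R^o h K hK.
(* All points used below have absolute value at most [|a| + eta]; the extra 1 keeps them off the
   ends of the window. *)
have [G dG] := @exists_antiderivative h (`|a| + eta + 1) ch.
have e0 := eta0; have aP : - `|a| <= a <= `|a| by rewrite -ler_norml.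
have dGa x : - (`|a| + eta) <= x <= `|a| + eta -> is_derive x 1 G (h x).
  by move=> xa; apply: dG; lra.
have -> : imean eta h = eta^-1 * (G eta - G 0).
  congr (_ * _); apply: derive_integral_segment => // x xeta; apply: dGa; lra.
have -> : imean eta (fun s => h (s + a)) = eta^-1 * (G (eta + a) - G a).
  rewrite /imean -[in G a](add0r a); congr (_ * _).
  apply: (derive_integral_segment (G := fun x => G (x + a))) => //.
  - apply: (@lipschitz_continuous R R^o R^o _ K) => y z.
    by apply: le_trans (hK _ _) _; rewrite opprD addrACA subrr addr0.
  - move=> x xeta.
    have dG1 : is_derive (x + a) 1 G (h (x + a)) by apply: dGa; lra.
    rewrite -[h _]mulr1.
    by apply: (@is_derive1_comp _ G (shift a) x); exact: is_derive_shift.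
pose D x := G (x + eta) - G x.
have dD x : - `|a| <= x <= `|a| -> is_derive x 1 D (h (x + eta) - h x).
  move=> xa; have xe : - (`|a| + eta) <= x + eta <= `|a| + eta by lra.
  have d1 := dGa _ xe.
  have d2 : is_derive x 1 G (h x) by apply: dGa; lra.
  apply: is_deriveB; rewrite -[h (x + eta)]mulr1.
  by apply: (@is_derive1_comp _ G (shift eta) x); exact: is_derive_shift.
have cD x : - `|a| <= x <= `|a| -> {for x, continuous D}.
  move=> /dD dDx; apply: differentiable_continuous.
  by apply/derivable1_diffP; exact: ex_derive.
(* Mean value theorem between 0 and [a], in whichever order they come. Moving [c] to 0 in the
   derivative changes it by at most [2 * K * |a|], the source of the quadratic remainder. *)
have [c ca Dc] : exists2 c, `|c| <= `|a| & D a - D 0 = a * (h (c + eta) - h c).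
  have [a0|a0] := leP 0 a.
    have [||c] := @MVT_segment R D (fun x => h (x + eta) - h x) 0 a a0.
    - by move=> x; rewrite in_itv/= => ?; apply: dD; lra.
    - apply: continuous_in_subspaceT => x; rewrite inE/= in_itv/= => ?; apply: cD; lra.
    rewrite in_itv/= => c01 ->; exists c; last by rewrite subr0 mulrC.
    by rewrite ger0_norm ?(le_trans _ (ler_norm a)); lra.
  have [||c] := @MVT_segment R D (fun x => h (x + eta) - h x) a 0 (ltW a0).
  - by move=> x; rewrite in_itv/= => ?; apply: dD; lra.
  - apply: continuous_in_subspaceT => x; rewrite inE/= in_itv/= => ?; apply: cD; lra.
  rewrite in_itv/= => c01 Dc; exists c; first by rewrite ler_norml; lra.
  by rewrite -opprB Dc; ring.
have -> : eta^-1 * (G (eta + a) - G a) - eta^-1 * (G eta - G 0) - a / eta * (h eta - h 0)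
    = a / eta * ((h (c + eta) - h eta) - (h c - h 0)).
  move: Dc; rewrite /D add0r [a + eta]addrC => Dc.
  rewrite -mulrBr Dc; ring.
rewrite normrM normrM normfV (gtr0_norm eta0).
have -> : 2 * K / eta * a ^+ 2 = `|a| / eta * (2 * K * `|a|).
  by rewrite -real_normK ?num_real//; ring.
apply: ler_wpM2l; first by rewrite divr_ge0// ltW.
apply: le_trans (ler_normB _ _) _.
have h1 := hK (c + eta) eta; have h2 := hK c 0.
rewrite addrK in h1; rewrite subr0 in h2.
have : K * `|c| <= K * `|a| by rewrite ler_wpM2l.
lra.
Qed.

End interval_mean.

(** * Steklov means along the coordinates *)

Section state_space.
Context {R : realType} {m : nat}.
Local Notation state := 'rV[R]_m.
Implicit Types (g h : state -> R) (v w y : state).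

Lemma coord_le_norm v i : `|v 0 i| <= `|v|.
Proof.
rewrite [leRHS]/Num.norm/= mx_normrE.
exact: (le_bigmax _ (fun ij : 'I_1 * 'I_m => `|v ij.1 ij.2|) (0, i)).
Qed.

Lemma norm_rV_le v (c : R) : 0 <= c -> (forall i, `|v 0 i| <= c) -> `|v| <= c.
Proof.
move=> c0 vc; rewrite [leLHS]/Num.norm/= mx_normrE.
by apply: bigmax_le => // -[i j] _ /=; rewrite ord1.
Qed.

Lemma norm_delta_le (i : 'I_m) : `|delta_mx 0 i : state| <= 1.
Proof.
by apply: norm_rV_le => // j; rewrite mxE eqxx/=; case: (j == i); rewrite ?normr1 ?normr0.
Qed.

Lemma norm_scale_delta_le (a : R) (i : 'I_m) : `|a *: (delta_mx 0 i : state)| <= `|a|.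
Proof. by rewrite normrZ ler_piMr// norm_delta_le. Qed.

Definition dot v w : R := \sum_i v 0 i * w 0 i.

Lemma dot_le v w : `|dot v w| <= m%:R * (`|v| * `|w|).
Proof.
apply: le_trans (ler_norm_sum _ _ _) _.
apply: (@le_trans _ _ (\sum_(i < m) `|v| * `|w|)).
  by apply: ler_sum => i _; rewrite normrM ler_pM// coord_le_norm.
by rewrite sumr_const card_ord mulr_natl.
Qed.

Lemma dotDr v w w' : dot v (w + w') = dot v w + dot v w'.
Proof. by rewrite -big_split; apply: eq_bigr => i _; rewrite mxE mulrDr. Qed.

Lemma dotBl v v' w : dot (v - v') w = dot v w - dot v' w.
Proof. by rewrite -sumrB; apply: eq_bigr => i _; rewrite !mxE mulrBl. Qed.

Lemma dot_delta v (a : R) i : dot v (a *: delta_mx 0 i) = a * v 0 i.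
Proof.
rewrite /dot (bigD1 i)//= !mxE !eqxx/= mulr1 big1 ?addr0 1?mulrC// => j ji.
by rewrite !mxE eqxx (negbTE ji) !mulr0.
Qed.

Lemma dotZr v (a : R) w : dot v (a *: w) = a * dot v w.
Proof.
by rewrite /dot mulr_sumr; apply: eq_bigr => i _; rewrite mxE mulrCA.
Qed.

Definition klip (K : R) h := forall x y, `|h x - h y| <= K * `|x - y|.

Lemma klip_line K h y i : 0 <= K -> klip K h ->
  forall s t : R, `|h (y + s *: delta_mx 0 i) - h (y + t *: delta_mx 0 i)| <= K * `|s - t|.
Proof.
move=> K0 hK s t; apply: le_trans (hK _ _) _; rewrite ler_wpM2l//.
by rewrite opprD addrACA subrr add0r -scalerBl norm_scale_delta_le.
Qed.

Lemma klip_continuous_line K h y i : 0 <= K -> klip K h ->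
  continuous (fun s : R => h (y + s *: delta_mx 0 i)).
Proof.
by move=> K0 hK; apply: (@lipschitz_continuous R R^o R^o _ K); exact: klip_line.
Qed.

Variables (eta : R) (eta0 : 0 < eta).

(** Averaging one coordinate at a time replaces convolution with a smooth kernel: integrals stay
    one-dimensional, and one mean per coordinate already turns a Lipschitz function into a C^1
    function. *)
Definition steklov i h y : R := imean eta (fun s => h (y + s *: delta_mx 0 i)).

Lemma steklov_klip K i h : 0 <= K -> klip K h -> klip K (steklov i h).
Proof.
move=> K0 hK x y; apply: imean_dist_le => //; [exact: klip_continuous_line hK..|].
by move=> s _; apply: le_trans (hK _ _) _; rewrite opprD addrACA subrr addr0.
Qed.

Lemma steklov_dist_le K i h y : 0 <= K -> klip K h ->
  `|steklov i h y - h y| <= K * eta.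
Proof.
move=> K0 hK; rewrite -[h y](imean_cst eta0).
apply: imean_dist_le => //; first exact: klip_continuous_line hK.
  by move=> s; exact: cvg_cst.
move=> s /andP[s0 se]; apply: le_trans (hK _ _) _; rewrite ler_wpM2l// addrC addKr.
by apply: le_trans (norm_scale_delta_le _ _) _; rewrite ger0_norm.
Qed.

(** The induction invariant of the mollification: a first order expansion with Lipschitz gradient
    and quadratic remainder, but only for displacements in the first [n] coordinates, those already
    averaged. The other entries of [d] are arbitrary. *)
Definition taylor_upto (n : nat) h : Prop :=
  exists (d : state -> state) (C L : R),
    [/\ 0 <= C, 0 <= L, forall x y, `|d x - d y| <= L * `|x - y| &
      forall y v, (forall i : 'I_m, (n <= i)%N -> v 0 i = 0) ->
        `|h (y + v) - h y - dot (d y) v| <= C * `|v| ^+ 2].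

(** The mean along [e_i] has the difference quotient of [h] over [eta] as its i-th partial
    derivative, and this is Lipschitz because [h] is. In the earlier coordinates the expansion of
    [h] is averaged. A displacement is split as [a *: e + w] with [w] in the earlier coordinates. *)
Lemma steklov_taylor K (i : 'I_m) h : 0 <= K -> klip K h ->
  taylor_upto i h -> taylor_upto i.+1 (steklov i h).
Proof.
move=> K0 hK [d [C [L [C0 L0 dL hd]]]].
pose e : state := delta_mx 0 i.
have dj j : klip L (fun y => d y 0 j).
  move=> x y; apply: le_trans (dL x y).
  by rewrite (le_trans _ (coord_le_norm _ j))// !mxE.
pose d' (y : state) : state := \row_j (if j == i then eta^-1 * (h (y + eta *: e) - h y)
  else steklov i (fun x => d x 0 j) y).
pose L' := eta^-1 * (K + K) + L.
have L'0 : 0 <= L' by rewrite addr_ge0// mulr_ge0 ?invr_ge0 ?(ltW eta0)// addr_ge0.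
have d'L x y : `|d' x - d' y| <= L' * `|x - y|.
  apply: norm_rV_le => [|j]; first by rewrite mulr_ge0.
  rewrite !mxE; case: eqP => _; last first.
    apply: (le_trans (steklov_klip i L0 (dj j) x y)).
    by rewrite ler_wpM2r// lerDr mulr_ge0 ?invr_ge0 ?(ltW eta0)// addr_ge0.
  rewrite -mulrBr normrM gtr0_norm ?invr_gt0//.
  apply: (@le_trans _ _ (eta^-1 * ((K + K) * `|x - y|))).
    rewrite ler_pM2l ?invr_gt0// mulrDl.
    rewrite (_ : h (x + eta *: e) - h x - _ =
      (h (x + eta *: e) - h (y + eta *: e)) - (h x - h y)); last ring.
    apply: (le_trans (ler_normB _ _)); apply: lerD; last exact: hK.
    by apply: (le_trans (hK _ _)); rewrite opprD addrACA subrr addr0.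
  by rewrite mulrA ler_wpM2r// lerDl.
(* The three terms come from the averaged expansion along [w] ([T1]), from moving the gradient from
   [ya] back to [y] ([T3]), and from [imean_translation] along [e] ([T2]). *)
exists d', (C + m%:R * L' + 2 * K / eta), L'; split => //.
- rewrite addr_ge0 ?addr_ge0 ?mulr_ge0//.
  by rewrite invr_ge0 ltW.
move=> y v vi; pose a := v 0 i; pose w := v - a *: e.
have vE : v = a *: e + w by rewrite /w addrC subrK.
have wi : forall j : 'I_m, (i <= j)%N -> w 0 j = 0.
  move=> j; rewrite leq_eqVlt => /predU1P[/val_inj <-|ij].
    by rewrite !mxE !eqxx mulr1 subrr.
  rewrite !mxE vi// eqxx/= (_ : (j == i) = false) ?mulr0 ?subr0//.
  by apply/negP => /eqP ji; rewrite ji ltnn in ij.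
have av : `|a| <= `|v| := coord_le_norm v i.
have wv : `|w| <= `|v|.
  apply: norm_rV_le => // j; rewrite !mxE eqxx/=.
  case: eqP => [->|_]; first by rewrite mulr1 subrr normr0.
  by rewrite mulr0 subr0 coord_le_norm.
pose ya := y + a *: e.
have T1 : `|steklov i h (ya + w) - steklov i h ya - dot (d' ya) w| <= C * `|w| ^+ 2.
  have cF (j : 'I_m) : continuous (fun s : R => d (ya + s *: e) 0 j * w 0 j).
    by move=> s; apply: cvgM; [exact: klip_continuous_line (dj j) s|exact: cvg_cst].
  have [cdw dwE] := imean_sum eta0 (index_enum 'I_m) cF.
  (* The i-th entry of [w] is 0, so the only entry of [d'] that is not a mean of [d] drops out. *)
  have -> : dot (d' ya) w = imean eta (fun s => dot (d (ya + s *: e)) w).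
    rewrite /dot dwE; apply: eq_bigr => j _; rewrite mxE.
    case: eqP => [->|_].
      rewrite wi// mulr0 -[LHS](imean_cst eta0); congr (imean _ _).
      by apply/funext => s; rewrite mulr0.
    rewrite mulrC -imeanZ//; last exact: klip_continuous_line (dj j).
    by congr (imean _ _); apply/funext => s; rewrite mulrC.
  have c1 : continuous (fun s : R => h (ya + w + s *: e)) by exact: klip_continuous_line hK.
  have c2 : continuous (fun s : R => h (ya + s *: e)) by exact: klip_continuous_line hK.
  have c12 : continuous (fun s : R => h (ya + w + s *: e) - h (ya + s *: e)).
    by move=> s; apply: cvgB; [exact: c1|exact: c2].
  rewrite -imeanB//; apply: imean_dist_le => //.
  - move=> s _; rewrite (_ : ya + w + s *: delta_mx 0 i = ya + s *: e + w) ?hd//.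
    by rewrite addrAC.
have T2 : `|steklov i h ya - steklov i h y - dot (d' y) (a *: e)| <= 2 * K / eta * a ^+ 2.
  rewrite dot_delta mxE eqxx.
  have := imean_translation eta0 a (klip_line y i K0 hK).
  rewrite scale0r addr0 mulrA; apply: le_trans.
  rewrite /steklov le_eqVlt; apply/orP; left; apply/eqP; congr (`|_ - _ - _|); last by rewrite mulrA.
  by congr (imean _ _); apply/funext => s; rewrite /ya scalerDl -addrA [a *: _ + _]addrC.
have T3 : `|dot (d' ya - d' y) w| <= m%:R * L' * (`|v| * `|v|).
  apply: (le_trans (dot_le _ _)); rewrite -mulrA ler_wpM2l//.
  rewrite mulrA ler_pM ?mulr_ge0//.
  apply: (le_trans (d'L _ _)); rewrite ler_wpM2l// /ya addrAC subrr add0r.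
  exact: le_trans (norm_scale_delta_le _ _) av.
have -> : y + v = ya + w by rewrite /ya -addrA -vE.
have -> : dot (d' y) v = dot (d' ya) w - dot (d' ya - d' y) w + dot (d' y) (a *: e).
  by rewrite dotBl [in LHS]vE dotDr; ring.
rewrite (_ : _ - _ - _ = (steklov i h (ya + w) - steklov i h ya - dot (d' ya) w) +
  (steklov i h ya - steklov i h y - dot (d' y) (a *: e)) + dot (d' ya - d' y) w); last ring.
have a2 : a ^+ 2 <= `|v| ^+ 2.
  by rewrite -(real_normK (num_real a)) !expr2; exact: ler_pM.
have w2 : `|w| ^+ 2 <= `|v| ^+ 2 by rewrite !expr2; exact: ler_pM.
apply: (le_trans (ler_normD _ _)); apply: (le_trans (lerD (ler_normD _ _) (lexx _))).
apply: (le_trans (lerD (lerD T1 T2) T3)).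
rewrite -expr2 (mulrDl _ (2 * K / eta)) (mulrDl C) [leRHS]addrAC lerD2r; apply: lerD; rewrite ler_wpM2l//.
by rewrite divr_ge0 ?mulr_ge0 ?(ltW eta0).
Qed.

Lemma steklov_translation K i h y w (A : R) : 0 <= K -> klip K h ->
  (forall s : R, 0 <= s <= eta ->
    h (y + s *: delta_mx 0 i) <= h (y + s *: delta_mx 0 i + w) + A) ->
  steklov i h y <= steklov i h (y + w) + A.
Proof.
move=> K0 hK hA; rewrite -lerBlDl -[leRHS](imean_cst eta0) -imeanB//;
  [|exact: klip_continuous_line hK..].
have c1 := klip_continuous_line (y := y) (i := i) K0 hK.
have c2 := klip_continuous_line (y := y + w) (i := i) K0 hK.
apply: le_imean => //.
- by move=> s; apply: cvgB; [exact: c1|exact: c2].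
- by move=> s; exact: cvg_cst.
- by move=> s /hA; rewrite lerBlDl addrAC.
Qed.

End state_space.

Section mollification.
Context {R : realType} {m : nat}.
Local Notation state := 'rV[R]_m.
Implicit Types (g h : state -> R) (v w y : state).

(** The last clause carries dynamic programming through the smoothing: means commute with
    translations, so an inequality between [g] and its translate by one fixed [w], valid at all
    nearby points, survives each averaging. *)
Lemma mollification_upto (K eta : R) g (n : nat) : 0 <= K -> 0 < eta ->
  klip K g -> (n <= m)%N ->
  exists h, [/\ klip K h, taylor_upto n h,
    forall y, `|h y - g y| <= n%:R * (K * eta) &
    forall y w (A : R), (forall s, `|s| <= n%:R * eta -> g (y + s) <= g (y + s + w) + A) ->
      h y <= h (y + w) + A].
Proof.
move=> K0 eta0 gK; elim: n => [_|n ih nm].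
  exists g; split => //.
  - exists (fun=> 0), 0, 0; split => //.
    + by move=> x y; rewrite subrr normr0 mul0r.
    + move=> y v v0; have -> : v = 0 by apply/rowP => i; rewrite v0// mxE.
      by rewrite addr0 /dot big1 ?subrr ?normr0 ?mul0r// => i _; rewrite mxE mul0r.
  - by move=> y; rewrite subrr normr0 mul0r.
  - by move=> y w A /(_ 0); rewrite normr0 mul0r addr0; exact.
have [h [hK hT hg hA]] := ih (ltnW nm).
exists (steklov eta (Ordinal nm) h); split.
- exact: steklov_klip.
- exact: (@steklov_taylor _ _ _ eta0 K (Ordinal nm)).
- move=> y; rewrite -natr1 mulrDl mul1r [leRHS]addrC.
  rewrite -(subrK (h y) (steklov _ _ _ _)) -addrA.
  apply: (le_trans (ler_normD _ _)); apply: lerD => //.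
  exact: steklov_dist_le.
- move=> y w A gA; apply: (@steklov_translation _ _ _ _ K) => // s /andP[s0 seta].
  apply: hA => t tn; rewrite -[_ + _ + t]addrA; apply: gA.
  apply: (le_trans (ler_normD _ _)); rewrite -natr1 mulrDl mul1r [leRHS]addrC lerD//.
  by apply: (le_trans (norm_scale_delta_le _ _)); rewrite ger0_norm.
Qed.

Lemma dot_is_linear v : linear (dot v : state -> R^o).
Proof. by move=> a w w'; rewrite dotDr dotZr. Qed.

HB.instance Definition _ v :=
  GRing.isLinear.Build R state R^o _ (dot v) (dot_is_linear v).

Lemma dot_continuous v : continuous (dot v : state -> R).
Proof.
apply: (@lipschitz_continuous R state R _ (m%:R * `|v|)) => x y.
have -> : dot v x - dot v y = dot v (x - y).
  by rewrite (linearB (dot v : {linear state -> R^o})).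
by rewrite -mulrA; exact: dot_le.
Qed.

(** The quadratic remainder is [o(|v|)], so uniqueness of the differential identifies [grad h] with
    the Lipschitz map [d]. *)
Lemma taylor_C1 h : taylor_upto m h -> C1 h.
Proof.
move=> [d [C [L [C0 L0 dL hd]]]].
have hd' y v : `|h (y + v) - h y - dot (d y) v| <= C * `|v| ^+ 2.
  by apply: hd => i; rewrite leqNgt ltn_ord.
have hdo y (e : R) : 0 < e ->
    \forall v \near (0 : state), `|h (v + y) - (h y + dot (d y) v)| <= e * `|v|.
  move=> e0; have C1 : 0 < C + 1 by rewrite ltr_wpDl.
  near=> v.
  rewrite (_ : h (v + y) - _ = h (y + v) - h y - dot (d y) v); last first.
    by rewrite [v + y]addrC opprD addrA.
  apply: (le_trans (hd' y v)); rewrite expr2 mulrA ler_wpM2r//.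
  apply: (@le_trans _ _ ((C + 1) * `|v|)); first by rewrite ler_wpM2r// lerDl.
  rewrite mulrC -ler_pdivlMr//; near: v.
  by apply: cvgr0_norm_le; [exact: cvg_id|exact: divr_gt0].
have hE y : 'd (h : state -> R^o) y = (dot (d y) : {linear state -> R^o}) :> (state -> R^o).
  apply: (@diff_unique R state R^o h (dot (d y)) y (@dot_continuous (d y))).
  by apply/eqaddoP => e e0; exact: hdo.
have dh y : differentiable (h : state -> R^o) y.
  apply/diff_locallyP; split; first by rewrite hE; exact: dot_continuous.
  by rewrite hE; apply/eqaddoP => e e0; exact: hdo.
split=> //.
have -> : grad h = d.
  apply/funext => y; apply/rowP => i; rewrite mxE deriveE// hE.
  by rewrite -[RHS]mul1r -dot_delta scale1r.
exact: lipschitz_continuous dL.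
Unshelve. all: by end_near. Qed.

Lemma mollification (K e : R) g : 0 <= K -> 0 < e -> klip K g ->
  exists h, [/\ C1 h, forall y, `|h y - g y| <= e &
    forall y w (A : R), (forall s, `|s| <= e -> g (y + s) <= g (y + s + w) + A) ->
      h y <= h (y + w) + A].
Proof.
(* This makes both the uniform error [m * K * eta] and the reach [m * eta] of the iterated means at
   most [e]; the added ones keep the divisor positive when [m] or [K] is 0. *)
move=> K0 e0 gK; pose eta := e / ((m%:R + 1) * (K + 1)).
have eta0 : 0 < eta by rewrite divr_gt0// mulr_gt0// ltr_wpDl.
have m0 : 0 <= m%:R :> R by [].
have metae : m%:R * (K * eta) <= e /\ m%:R * eta <= e.
  have etaE : eta * ((m%:R + 1) * (K + 1)) = e.
    by rewrite /eta divfK// gt_eqF// mulr_gt0// ltr_wpDl.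
  have Ke0 : 0 <= K * eta by rewrite mulr_ge0// ltW.
  have me0 : 0 <= m%:R * eta by rewrite mulr_ge0// ltW.
  have mKe0 : 0 <= m%:R * (K * eta) by rewrite mulr_ge0.
  have eE : e = m%:R * (K * eta) + m%:R * eta + K * eta + eta by rewrite -etaE; ring.
  by split; rewrite [leRHS]eE; lra.
have [h [hK hT hg hA]] := mollification_upto K0 eta0 gK (leqnn m).
exists h; split; first exact: taylor_C1.
- by move=> y; apply: (le_trans (hg y)); case: metae.
- by move=> y w A gA; apply: hA => s sm; apply: gA; apply: (le_trans sm); case: metae.
Qed.

End mollification.

Section directional_derivative.
Context {R : realType} {m : nat} {U : pmetricType R}.
Local Notation state := 'rV[R]_m.

Lemma grad_dot_derive (f : state -> U -> state) (h : state -> R) (x : state * U) :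
  C1 h -> grad_dot f h x = 'D_(f x.1 x.2) h x.1.
Proof.
move=> [dh _]; rewrite /grad_dot deriveE//.
rewrite {2}[f x.1 x.2]matrix_sum_delta big_ord1 linear_sum/=.
apply: eq_bigr => i _; rewrite mxE deriveE//.
by rewrite linearZ/= mulrC.
Qed.

(** Dividing by [tau] and letting it decrease to 0 removes the quadratic term. This is where the
    short-time inequality becomes a differential one. *)
Lemma derive_ge (h : state -> R) (y v : state) (a b tau0 : R) :
  C1 h -> 0 < tau0 ->
  (forall tau, 0 < tau < tau0 -> h y <= h (y + tau *: v) + (a * tau + b * tau ^+ 2)) ->
  - a <= 'D_v h y.
Proof.
move=> [dh _] t0 hv.
have dhv : derivable h y v by exact: diff_derivable.
have c1 : (fun t : R => t^-1 *: (h (t *: v + y) - h y)) @ 0^'+ --> 'D_v h y.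
  exact: cvg_dnbhs_at_right dhv.
have c2 : (fun t : R => - a - b * t) @ 0^'+ --> - a.
  rewrite -[X in _ --> X]subr0 -{2}(mulr0 b).
  by apply: cvgB; [exact: cvg_cst|apply: cvgMr; exact: cvg_at_right_filter cvg_id].
apply: (ler_cvg_to c2 c1).
near=> t.
have tp : 0 < t by near: t; exact: nbhs_right_gt.
have tt : t < tau0 by near: t; exact: nbhs_right_lt.
have := hv t; rewrite tp tt => /(_ isT) H.
rewrite /= -ler_pdivrMl ?invr_gt0// invrK [t *: v + y]addrC; nra.
Unshelve. all: by end_near. Qed.

End directional_derivative.

(** * Existence of solutions for a constant control *)

(** The explicit rate makes the pointwise limits of the Picard iterates uniform in time;
    [le_geometric_slack] then passes inequalities to the limit. *)
Lemma geometric_cauchy (R : realType) (V : completeNormedModType R) (u : nat -> V) (C : R) :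
  0 <= C -> (forall n, `|u n.+1 - u n| <= C * 2^-1 ^+ n) ->
  exists l, forall n, `|l - u n| <= 2 * C * 2^-1 ^+ n.
Proof.
move=> C0 uC.
have p0 n : 0 <= (2^-1 : R) ^+ n by rewrite exprn_ge0.
have dist n k : `|u (n + k)%N - u n| <= 2 * C * 2^-1 ^+ n - 2 * C * 2^-1 ^+ (n + k).
  elim: k => [|k ih]; first by rewrite addn0 !subrr normr0.
  rewrite addnS -(subrK (u (n + k)%N) (u (n + k).+1)) -addrA.
  apply: (le_trans (ler_normD _ _)); apply: (le_trans (lerD (uC _) ih)).
  by rewrite exprS; lra.
have distn n p : (n <= p)%N -> `|u p - u n| <= 2 * C * 2^-1 ^+ n.
  move=> np; rewrite -(subnKC np); apply: (le_trans (dist _ _)).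
  by rewrite gerBl mulr_ge0 ?mulr_ge0.
have g0 : (fun n => 2 * C * 2^-1 ^+ n) @ \oo --> (0 : R).
  by apply: cvg_geometric; rewrite ger0_norm// invf_lt1// ltr1n.
have cu : cvgn u.
  apply/cauchy_cvgP/cauchy_exP => e e0.
  have [N _ HN] : \forall n \near \oo, 2 * C * 2^-1 ^+ n < e.
    by have := cvgr_lt _ g0; apply.
  exists (u N); exists N => // p /= Np; rewrite -ball_normE/= distrC.
  by apply: le_lt_trans (distn _ _ Np) _; exact: HN N (leqnn N).
exists (limn u) => n.
have c1 : (fun p => `|u p - u n|) @ \oo --> `|limn u - u n|.
  by apply: cvg_norm; apply: cvgB => //; exact: cvg_cst.
apply: (cvgr_to_le c1); exists n => // p /= np.
exact: distn.
Qed.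

Section vector_integral.
Context {R : realType} {m : nat}.
Local Notation state := 'rV[R]_m.
Local Notation leb := (@lebesgue_measure R).
Implicit Types (g : R -> state).

Definition vint (t : R) g : state := \row_i \int[leb]_(s in `[0, t]) g s 0 i.

Lemma continuous_coord g i : continuous g -> continuous (fun s => g s 0 i).
Proof.
move=> cg s; apply: (@continuous_comp _ _ _ g (fun v : state => v 0 i)).
  exact: cg.
exact: coord_continuous.
Qed.

Lemma Rintegral_le_bound (h : R -> R) (a b c : R) : a <= b -> continuous h ->
  (forall s, a <= s <= b -> `|h s| <= c) ->
  `|\int[leb]_(s in `[a, b]) h s| <= c * (b - a).
Proof.
move=> ab ch hc.
have ih : leb.-integrable `[a, b] (EFin \o h) by exact: integrable_segment.
apply: (le_trans (le_normr_Rintegral _ ih)) => //.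
have -> : c * (b - a) = \int[leb]_(s in `[a, b]) c.
  rewrite Rintegral_cst//= lebesgue_measure_itv/= lte_fin.
  by case: ltgtP ab => // -> _; rewrite subrr mulr0.
apply: le_Rintegral => //; first exact: (integrable_norm ih).
by apply: (@integrable_segment _ (cst c)); move=> s; exact: cvg_cst.
Qed.

Lemma vint_le g (t c : R) : 0 <= t -> 0 <= c -> continuous g ->
  (forall s, 0 <= s <= t -> `|g s| <= c) -> `|vint t g| <= c * t.
Proof.
move=> t0 c0 cg gc; apply: norm_rV_le => [|i]; first exact: mulr_ge0.
rewrite mxE -[X in _ * X]subr0; apply: Rintegral_le_bound => //.
  exact: continuous_coord.
by move=> s /gc; apply: le_trans; exact: coord_le_norm.
Qed.

Lemma vintB g g' (t : R) : continuous g -> continuous g' ->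
  vint t g - vint t g' = vint t (fun s => g s - g' s).
Proof.
move=> cg cg'; apply/rowP => i; rewrite !mxE -RintegralB//.
- by apply: eq_Rintegral => s _; rewrite !mxE.
- exact/integrable_segment/continuous_coord.
- exact/integrable_segment/continuous_coord.
Qed.

Lemma vint_dist_le g (t t' c : R) : 0 <= t -> 0 <= t' -> 0 <= c -> continuous g ->
  (forall s, `|g s| <= c) -> `|vint t g - vint t' g| <= c * `|t - t'|.
Proof.
wlog tt' : t t' / t' <= t.
  move=> H t0 t'0 c0 cg gc; have [tt'|/ltW tt'] := leP t' t; first exact: H.
  by rewrite distrC (distrC t); exact: H.
move=> t0 t'0 c0 cg gc; apply: norm_rV_le => [|i]; first by rewrite mulr_ge0.
have cgi := continuous_coord (i := i) cg.
rewrite !mxE Rintegral_itvB; [|exact: integrable_segment|by rewrite bnd_simp..].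
rewrite Rintegral_itv_obnd_cbnd; last first.
  by apply: (integrableS _ _ _ (integrable_segment t' t cgi)) => //; exact: subset_itv_oc_cc.
rewrite (ger0_norm (_ : 0 <= t - t')) ?subr_ge0//; apply: Rintegral_le_bound => //.
by move=> s _; apply: le_trans (gc s); exact: coord_le_norm.
Qed.

Lemma vint_cst (v : state) (t : R) : 0 <= t -> vint t (cst v) = t *: v.
Proof.
move=> t0; apply/rowP => i; rewrite !mxE Rintegral_cst//= lebesgue_measure_itv/= lte_fin.
by case: ltgtP t0 => [_ _||<- _] //=; rewrite ?subr0 ?mulr0 ?mul0r// mulrC.
Qed.

End vector_integral.

Lemma le_geometric_slack (R : realType) (a b C : R) :
  (forall n, a <= b + C * 2^-1 ^+ n) -> a <= b.
Proof.
move=> abC.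
have cg : (fun n => b + C * 2^-1 ^+ n) @ \oo --> b.
  rewrite -[X in _ --> X]addr0; apply: cvgD; first exact: cvg_cst.
  by apply: cvg_geometric; rewrite ger0_norm// invf_lt1// ltr1n.
by apply: (cvgr_to_ge cg); exists 0%N => // n _; exact: abC.
Qed.

Lemma geometric_cauchy_rV (R : realType) (m : nat) (u : nat -> 'rV[R]_m) (C : R) :
  0 <= C -> (forall n, `|u n.+1 - u n| <= C * 2^-1 ^+ n) ->
  exists l, forall n, `|l - u n| <= 2 * C * 2^-1 ^+ n.
Proof.
move=> C0 uC.
have /choice[l lu] : forall i, exists l : R, forall n, `|l - u n 0 i| <= 2 * C * 2^-1 ^+ n.
  move=> i; apply: (@geometric_cauchy R R^o (fun n => u n 0 i)) => // n.
  by apply: (le_trans _ (uC n)); rewrite (le_trans _ (coord_le_norm _ i))// !mxE.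
exists (\row_i l i) => n; apply: norm_rV_le => [|i]; last by rewrite !mxE.
by rewrite !mulr_ge0// exprn_ge0.
Qed.

Lemma max_dist_le (R : realType) (a x y : R) :
  `|Num.max x a - Num.max y a| <= `|x - y|.
Proof.
have P : - `|x - y| <= x - y <= `|x - y| by rewrite -ler_norml.
by rewrite ler_norml; case: (leP x a) => ?; case: (leP y a) => ?; lra.
Qed.

Lemma min_dist_le (R : realType) (a x y : R) :
  `|Num.min x a - Num.min y a| <= `|x - y|.
Proof.
have P : - `|x - y| <= x - y <= `|x - y| by rewrite -ler_norml.
by rewrite ler_norml; case: (leP x a) => ?; case: (leP y a) => ?; lra.
Qed.

Lemma clamp_dist_le (R : realType) (a b x y : R) :
  `|Num.min (Num.max x a) b - Num.min (Num.max y a) b| <= `|x - y|.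
Proof. exact: le_trans (min_dist_le _ _ _) (max_dist_le _ _ _). Qed.

Section picard.
Context {R : realType} {m : nat}.
Local Notation state := 'rV[R]_m.
Variables (F : state -> state) (L tau : R) (y : state).
Hypotheses (L0 : 0 <= L) (tau0 : 0 < tau) (Ltau : L * tau <= 2^-1).
Hypothesis FL : forall x x', `|F x - F x'| <= L * `|x - x'|.

(** A self-consistent speed bound: on a curve within [K * tau] of [y], the size of [F] is at most
    [|F y| + L * K * tau <= K / 2 + K / 2]. *)
Let K : R := 2 * `|F y|.

(* Freezing the time outside [0, tau] makes all iterates globally Lipschitz. *)
Let cl (t : R) : R := Num.min (Num.max t 0) tau.

Let picard_op (X : R -> state) (t : R) : state := y + vint (cl t) (F \o X).

Let good (X : R -> state) : Prop :=
  (forall s t, `|X s - X t| <= K * `|s - t|) /\ forall t, `|X t - y| <= K * tau.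

Let K0 : 0 <= K. Proof. by rewrite mulr_ge0. Qed.

Let cl_itv t : 0 <= cl t <= tau.
Proof.
rewrite /cl; have t0 := tau0.
by case: (leP t 0) => ?; case: (leP t tau) => ?; case: (leP 0 tau) => ?; lra.
Qed.

Let cl_id t : 0 <= t <= tau -> cl t = t.
Proof.
move=> /andP[t0 tt]; rewrite /cl.
by case: (leP t 0) => ?; case: (leP t tau) => ?; case: (leP 0 tau) => ?; lra.
Qed.

Let cl_lip s t : `|cl s - cl t| <= `|s - t|.
Proof. exact: clamp_dist_le. Qed.

Let good_bound X s : good X -> `|F (X s)| <= K.
Proof.
move=> [_ Xy]; rewrite -(subrK (F y) (F (X s))); apply: (le_trans (ler_normD _ _)).
have : `|F (X s) - F y| <= L * (K * tau).
  by apply: (le_trans (FL _ _)); rewrite ler_wpM2l.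
have : L * (K * tau) <= 2^-1 * K by rewrite mulrCA mulrC ler_wpM2r.
have KE : K = 2 * `|F y| by [].
by move=> ? ?; lra.
Qed.

Let F_continuous (X : R -> state) (C : R) : (forall s t, `|X s - X t| <= C * `|s - t|) ->
  continuous (F \o X).
Proof.
move=> XK; apply: (@lipschitz_continuous R R^o state _ (L * C)) => s t.
by apply: (le_trans (FL _ _)); rewrite -mulrA ler_wpM2l.
Qed.

Let good_op X : good X -> good (picard_op X).
Proof.
move=> gX; have cFX := F_continuous gX.1; split=> [s t|t].
  rewrite /picard_op opprD addrACA subrr add0r.
  have /andP[? ?] := cl_itv s; have /andP[? ?] := cl_itv t.
  apply: (@le_trans _ _ (K * `|cl s - cl t|)); last by rewrite ler_wpM2l.
  by apply: vint_dist_le => // r; exact: good_bound.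
have /andP[? ?] := cl_itv t.
rewrite /picard_op addrC addKr; apply: (@le_trans _ _ (K * cl t)); last by rewrite ler_wpM2l.
by apply: vint_le => // r _; exact: good_bound.
Qed.

Let op_dist X X' (C : R) t : good X -> good X' -> 0 <= C ->
  (forall s, `|X s - X' s| <= C) -> `|picard_op X t - picard_op X' t| <= 2^-1 * C.
Proof.
move=> gX gX' C0 XX'.
rewrite /picard_op opprD addrACA subrr add0r vintB; [|exact: F_continuous gX.1|exact: F_continuous gX'.1].
have /andP[c0 ct] := cl_itv t.
apply: (@le_trans _ _ ((L * C) * cl t)); last first.
  apply: (@le_trans _ _ ((L * C) * tau)); first by rewrite ler_wpM2l// mulr_ge0.
  by rewrite mulrAC ler_wpM2r.
apply: vint_le => //; first by rewrite mulr_ge0.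
- by move=> s; apply: cvgB; [exact: F_continuous gX.1 s|exact: F_continuous gX'.1 s].
- by move=> s _; apply: (le_trans (FL _ _)); rewrite ler_wpM2l.
Qed.

(** As [L * tau <= 1/2], [picard_op] halves the uniform distance. A short interval is what the
    dynamic programming step calls for, and the last clause keeps the arc in a prescribed ball
    around [y]. *)
Lemma picard : exists x : R -> state, [/\ continuous x,
  forall t, 0 <= t <= tau -> x t = y + vint t (F \o x) &
  forall t, 0 <= t <= tau -> `|x t - y| <= 2 * `|F y| * t].
Proof.
pose u n := iter n picard_op (cst y).
have g0 : good (cst y).
  have := tau0; split=> *; rewrite subrr normr0 mulr_ge0//; exact: ltW.
have gu n : good (u n) by elim: n => [//|n ih]; exact: good_op.
have Kt0 : 0 <= K * tau by rewrite mulr_ge0// ltW.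
have p0 n : 0 <= (2^-1 : R) ^+ n by rewrite exprn_ge0.
have du n t : `|u n.+1 t - u n t| <= K * tau * 2^-1 ^+ n.
  elim: n t => [|n ih] t; first by rewrite expr0 mulr1; exact: (gu 1%N).2.
  rewrite exprS mulrCA; apply: (op_dist _ (gu n.+1) (gu n)) => //; exact: mulr_ge0.
have /choice[x xu] : forall t, exists l, forall n, `|l - u n t| <= 2 * (K * tau) * 2^-1 ^+ n.
  by move=> t; apply: (geometric_cauchy_rV Kt0) => n; exact: du.
have gx : good x.
  split=> [s t|t].
    apply: (@le_geometric_slack _ _ _ (4 * (K * tau))) => n.
    rewrite (_ : x s - x t = (x s - u n s) + (u n s - u n t) - (x t - u n t)); last first.
      by apply/rowP => i; rewrite !mxE; ring.
    apply: (le_trans (ler_normB _ _)); apply: (le_trans (lerD (ler_normD _ _) (lexx _))).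
    by have := xu s n; have := xu t n; have := (gu n).1 s t; lra.
  apply: (@le_geometric_slack _ _ _ (2 * (K * tau))) => n.
  rewrite -(subrK (u n t) (x t)) -addrA; apply: (le_trans (ler_normD _ _)).
  by have := xu t n; have := (gu n).2 t; lra.
have xE t : 0 <= t <= tau -> x t = y + vint t (F \o x).
  move=> tt; have -> : y + vint t (F \o x) = picard_op x t by rewrite /picard_op cl_id.
  apply/eqP; rewrite -subr_eq0 -normr_le0.
  apply: (@le_geometric_slack _ _ _ (2 * (K * tau))) => n; rewrite add0r.
  rewrite -(subrK (u n.+1 t) (x t)) -addrA; apply: (le_trans (ler_normD _ _)).
  have H : `|u n.+1 t - picard_op x t| <= 2^-1 * (2 * (K * tau) * 2^-1 ^+ n).
    apply: (op_dist _ (gu n) gx) => //; first by rewrite mulr_ge0 // mulr_ge0.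
    by move=> s; rewrite distrC.
  by have := xu t n.+1; rewrite exprS; lra.
exists x; split => //.
  exact: (@lipschitz_continuous R R^o state x K) gx.1.
move=> t /[dup] /andP[t0 _] tt; rewrite xE// addrC addKr.
by apply: vint_le => // [|s _]; [exact: F_continuous gx.1|exact: good_bound].
Qed.

End picard.

(** * Processes *)

Lemma countable_bigcup_measurable d (T : measurableType d) (I : choiceType) (B : set I)
    (F : I -> set T) :
  countable B -> (forall i, B i -> measurable (F i)) ->
  measurable (\bigcup_(i in B) F i).
Proof.
move=> /countable_injP[g ginj] mF.
have -> : \bigcup_(i in B) F i =
    \bigcup_n \bigcup_(i in B `&` g @^-1` [set n]) F i.
  apply/seteqP; split=> [t [i Bi Fi]|t [n _ [i [Bi _] Fi]]]; last by exists i.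
  by exists (g i) => //; exists i.
apply: bigcupT_measurable => n.
have [[i [Bi /= gi]]|no] := pselect (exists i, (B `&` g @^-1` [set n]) i).
  rewrite (_ : B `&` _ = [set i]); first by rewrite bigcup_set1; exact: mF.
  apply/seteqP; split=> [j [Bj /= gj]|_ ->]; last by [].
  by apply: ginj; rewrite ?inE// gj gi.
rewrite (_ : B `&` _ = set0) ?bigcup_set0//.
by apply/seteqP; split=> // i Bi; apply: no; exists i.
Qed.

Section process_measurability.
Context {R : realType} {m : nat} {U : pmetricType R}.
Local Notation state := 'rV[R]_m.
Local Notation stateU := ('rV[R]_m * U)%type.
Local Notation RR := (measurableTypeR R).
Local Notation leb := (@lebesgue_measure R).

Lemma measurable_to_gen d (T : measurableType d) (S : pointedType) (G : set (set S))
    (D : set T) (h : T -> S) :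
  (forall W : set S, G W -> measurable (D `&` h @^-1` W)) ->
  @measurable_fun _ _ T (g_sigma_algebraType G) D h.
Proof.
move=> hW; apply: (@measurability _ _ T (g_sigma_algebraType G) D h G) => //.
by move=> _ [W GW <-]; exact: hW.
Qed.

Lemma measurable_from_gen (S : pointedType) (G : set (set S)) (h : S -> R) :
  (forall W : set R, open W -> G (h @^-1` W)) ->
  @measurable_fun _ _ (g_sigma_algebraType G) RR setT h.
Proof.
move=> hW; apply: (measurability _ (RGenOpens.measurableE R)) => //.
move=> _ [_ [a [b ->]] <-]; rewrite setTI; apply: sub_sigma_algebra.
by apply: hW; exact: interval_open.
Qed.

(* An open subset of the product is a countable union of open rectangles,
   because the compact metric space U has a countable base. *)
Lemma measurable_borel_pair d (T : measurableType d) (x : T -> state) (u : T -> U) :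
  compact [set: U] ->
  @measurable_fun _ _ T (borelType state) setT x ->
  @measurable_fun _ _ T (borelType U) setT u ->
  @measurable_fun _ _ T (borelType stateU) setT (fun t => (x t, u t)).
Proof.
move=> cU mx mu; apply: measurable_to_gen => W oW; rewrite setTI.
have [B cB [oB bB]] := @compact_second_countable R U cU.
(* [V b] is the largest open set whose product with [b] lies in [W]. Taking it whole leaves a union
   indexed by the countable base of [U] alone. *)
pose V (b : set U) : set state :=
  \bigcup_(A in [set A : set state | open A /\ A `*` b `<=` W]) A.
have oV b : open (V b) by apply: bigcup_open => A [].
have -> : (fun t => (x t, u t)) @^-1` W =
    \bigcup_(b in B) (x @^-1` V b `&` u @^-1` b).
  apply/seteqP; split=> [t /= Wt|t [b Bb [[A [oA AbW] Axt] but]]].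
    have : nbhs (x t, u t) W by exact: open_nbhs_nbhs.
    move=> [[A0 b0] [/= nA nb] AbW].
    have [b [Bb but] bb0] := bB _ _ nb.
    exists b => //; split => //.
    exists (interior A0); last exact: nbhs_singleton (nbhs_interior nA).
    split; first exact: open_interior.
    move=> [y v] [/= Ay bv]; apply: AbW; split => /=.
      exact: interior_subset Ay.
    exact: bb0.
  exact: AbW.
apply: countable_bigcup_measurable => // b Bb.
apply: measurableI.
  rewrite -[X in measurable X]setTI; apply: (mx measurableT).
  exact: sub_sigma_algebra.
rewrite -[X in measurable X]setTI; apply: (mu measurableT).
by apply: sub_sigma_algebra; exact: oB.
Qed.

Lemma continuous_measurable_stateU (h : stateU -> R) :
  continuous h -> @measurable_fun _ _ (borelType stateU) RR setT h.
Proof.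
by move=> ch; apply: measurable_from_gen => W oW; apply: open_comp => // x _; exact: ch.
Qed.

Lemma continuous_measurable_state (x : R -> state) :
  continuous x -> @measurable_fun _ _ RR (borelType state) setT x.
Proof.
move=> cx; apply: measurable_to_gen => W oW; rewrite setTI.
by apply: open_measurable; apply: open_comp => // y _; exact: cx.
Qed.

End process_measurability.

Lemma within_continuous_comp (S T W : topologicalType) (A : set T) (g : S -> T) (h : T -> W) :
  {within A, continuous h} -> continuous g -> (forall s, A (g s)) ->
  continuous (h \o g).
Proof.
move=> ch cg Ag s V /= nV.
have := ch (g s) V nV; rewrite /nbhs/= -nbhs_subspace_in//= => hV.
have hV' : nbhs (g s) [set y | A y -> V (h y)] := hV.
have gV : nbhs s (g @^-1` [set y | A y -> V (h y)]) := cg s _ hV'.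
by apply: filterS gV => x /= /(_ (Ag x)).
Qed.

Section translation.
Context {R : realType}.
Local Notation leb := (@lebesgue_measure R).
Local Notation RR := (measurableTypeR R).

Lemma Rintegral_translation_split (h : RR -> RR) (s t M : R) :
  0 <= s -> 0 <= t -> measurable_fun setT h -> (forall x, `|h x| <= M) ->
  \int[leb]_(x in `[0, t + s]) h x =
  \int[leb]_(x in `[0, s]) h x +
  \int[leb]_(x in `[0, t]) h (x + s).
Proof.
move=> s0 t0 mh hM.
have ms : measurable_fun [set: RR] (fun x : RR => x + s : RR).
  exact: measurable_funD.
have mhs : measurable_fun [set: RR] (fun x : RR => h (x + s)) by exact: measurableT_comp.
have ib (g : RR -> RR) (i : interval R) a b : [set` i] `<=` `[a, b]%classic ->
    measurable_fun [set: RR] g -> (forall x, `|g x| <= M) ->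
    leb.-integrable [set` i] (EFin \o g).
  move=> iab mg gM; apply: (@integrableS _ _ _ leb `[a, b]%classic [set` i]) => //.
  apply: measurable_bounded_integrable => //.
  - by rewrite /= lebesgue_measure_itv/=; case: ifP; rewrite ?ltry.
  - exact: measurable_funTS.
  - exists M; split; first exact: num_real.
    by move=> x Mx y _; exact: le_trans (gM y) (ltW Mx).
rewrite [RHS]addrC; apply/eqP; rewrite -subr_eq; apply/eqP.
rewrite Rintegral_itvB; [|exact: (ib _ _ 0 (t + s))|by rewrite bnd_simp|by rewrite bnd_simp lerDr].
rewrite -[RHS]Rintegral_itv_obnd_cbnd; last first.
  by apply: (ib _ _ 0 t) => //; exact: subset_itv_oc_cc.
rewrite /Rintegral; congr fine.
have pE : (fun x : R => x + s) @^-1` `]s, t + s]%classic = `]0, t]%classic.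
  by apply/seteqP; split=> x /=; rewrite !in_itv/= => ?; lra.
transitivity (\int[leb]_(x in (fun x : RR => (x + s)%R : RR) @^-1` `]s, (t + s)%R]%classic)
    ((EFin \o h) \o (fun x : RR => (x + s)%R : RR)) x)%E; last by rewrite pE.
rewrite -(integral_pushforward ms)//.
- by apply: eq_measure_integral => A mA _; rewrite /= /pushforward/= lebesgue_measure_translation.
- exact/measurable_EFinP.
- rewrite pE; apply: (ib (fun x => h (x + s)) _ 0 t) => //.
  exact: subset_itv_oc_cc.
Qed.

End translation.

Section processes.
Context {R : realType} {m : nat} {U : pmetricType R}.
Local Notation state := 'rV[R]_m.
Local Notation stateU := ('rV[R]_m * U)%type.
Local Notation RR := (measurableTypeR R).
Local Notation leb := (@lebesgue_measure R).
Local Notation process := ((R -> U) * (R -> state))%type.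
Implicit Types (p q : process) (Z : set state).

(* Freezing the process at negative times makes it a total measurable map. *)
Definition path p (t : R) : stateU := (p.2 (Num.max t 0), p.1 (Num.max t 0)).

Lemma path_ge0 p t : 0 <= t -> path p t = (p.2 t, p.1 t).
Proof. by move=> t0; rewrite /path max_l. Qed.

Definition shift_process p (s : R) : process := (fun t => p.1 (t + s), fun t => p.2 (t + s)).

Lemma path_shift p (s t : R) : 0 <= s -> 0 <= t ->
  path (shift_process p s) t = path p (t + s).
Proof. by move=> s0 t0; rewrite !path_ge0// addr_ge0. Qed.

(** Writing the trajectory as a stopped arc plus a delayed increment makes continuity immediate.
    When [q.2 0 = p.2 tau], the increment vanishes up to [tau] and turns the sum into [q]
    afterwards. *)
Definition concat_process p (tau : R) q : process :=
  (fun t => if t < tau then p.1 t else q.1 (t - tau),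
   fun t => p.2 (Num.min (Num.max t 0) tau) + (q.2 (Num.max (t - tau) 0) - p.2 tau)).

Lemma max0_continuous : continuous (fun t : R => Num.max t 0).
Proof.
apply: (@lipschitz_continuous R R^o R^o _ 1) => x y; rewrite mul1r.
exact: max_dist_le.
Qed.

Section measurable.
Variable U_compact : compact [set: U].

Lemma measurable_path p : measurable_control p.1 ->
  {within `[0, +oo[, continuous p.2} ->
  @measurable_fun _ _ RR (borelType stateU) setT (path p).
Proof.
move=> mu cx; apply: measurable_borel_pair => //.
  apply: continuous_measurable_state.
  apply: (within_continuous_comp cx max0_continuous) => t /=.
  by rewrite in_itv/= andbT le_max lexx orbT.
apply: (measurable_comp _ _ mu) => //.
  by move=> _ [t _ <-] /=; rewrite in_itv/= andbT le_max lexx orbT.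
exact: (continuous_measurable_fun max0_continuous).
Qed.

Lemma measurable_along p (h : stateU -> R) : continuous h ->
  measurable_control p.1 -> {within `[0, +oo[, continuous p.2} ->
  @measurable_fun _ _ RR RR setT (fun t => h (path p t)).
Proof.
move=> ch mu cx; apply: (measurableT_comp (continuous_measurable_stateU ch)).
exact: measurable_path.
Qed.

Variables (f : state -> U -> state) (Z : set state) (C : R).
Hypothesis f_cont : continuous (fun x : stateU => f x.1 x.2).
Hypothesis fC : forall y u, Z y -> `|f y u| <= C.

Let fcoord i (x : stateU) : R := f x.1 x.2 0 i.

Let fcoord_cont i : continuous (fcoord i).
Proof.
move=> x.
apply: (@continuous_comp _ _ _ (fun x : stateU => f x.1 x.2) (fun v : state => v 0 i)).
  exact: f_cont.
exact: coord_continuous.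
Qed.

Let in_path p t : (forall t, t \in `[0, +oo[ -> Z (p.2 t)) -> Z (path p t).1.
Proof. by move=> Zp; apply: Zp; rewrite in_itv/= andbT le_max lexx orbT. Qed.

Let fcoord_path p i t : (forall t, t \in `[0, +oo[ -> Z (p.2 t)) ->
  `|fcoord i (path p t)| <= C.
Proof.
by move=> Zp; apply: (le_trans (coord_le_norm _ i)); apply: fC; exact: in_path.
Qed.

Let Rintegral_path p i t :
  \int[leb]_(s in `[0, t]) f (p.2 s) (p.1 s) 0 i =
  \int[leb]_(s in `[0, t]) fcoord i (path p s).
Proof.
apply: eq_Rintegral => s; rewrite inE/= in_itv/= => /andP[s0 _].
by rewrite path_ge0.
Qed.

Lemma admissible_shift p y0 (s : R) : 0 <= s ->
  admissible_inf f Z y0 p -> admissible_inf f Z (p.2 s) (shift_process p s).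
Proof.
move=> s0 [mu [cx xE] Zp].
have mp i := measurable_along (@fcoord_cont i) mu cx.
have bp i t := @fcoord_path p i t Zp.
split => /=.
- apply: (measurable_comp _ _ mu) => //.
    move=> _ [t t0 <-]; move: t0; rewrite /= !in_itv/= !andbT => t0; exact: addr_ge0.
  exact: measurable_funD.
- split.
    have cs : continuous (fun t : R => Num.max t 0 + s).
      by move=> t; apply: cvgD; [exact: max0_continuous|exact: cvg_cst].
    have cxs : continuous (p.2 \o (fun t : R => Num.max t 0 + s)).
      apply: (within_continuous_comp cx cs) => t /=.
      by rewrite in_itv/= andbT addr_ge0// le_max lexx orbT.
    apply: (subspace_eq_continuous (f := p.2 \o (fun t : R => Num.max t 0 + s))).
      by move=> t; rewrite inE/= in_itv/= andbT => t0; rewrite /from_subspace/= max_l.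
    exact: continuous_subspaceT.
  move=> t t0; rewrite (xE (t + s)) ?addr_ge0// (xE s)// -addrA; congr (_ + _).
  apply/rowP => i; rewrite !mxE !Rintegral_path.
  rewrite (Rintegral_translation_split s0 t0 (mp i) (bp i)); congr (_ + _).
  by apply: eq_Rintegral => r; rewrite inE/= in_itv/= => /andP[r0 _]; rewrite path_ge0 ?addr_ge0.
- by move=> t; rewrite /= !in_itv/= !andbT => t0; apply: Zp; rewrite /= in_itv/= andbT addr_ge0.
Qed.

Lemma path_concat p q (tau t : R) : 0 <= tau -> 0 <= t -> q.2 0 = p.2 tau ->
  path (concat_process p tau q) (t + tau) = path q t.
Proof.
move=> tau0 t0 q0; rewrite !path_ge0 ?addr_ge0//= ltNge lerDr t0/= addrK.
rewrite (max_l t0) max_l ?addr_ge0// min_r ?lerDr// addrCA subrr addr0 //.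
Qed.

(** The trajectory of [p] is constrained on [0, tau] only, so the initial piece may be a
    finite-horizon process as well as an arc produced by [picard]. *)
Lemma admissible_concat p q y0 (tau : R) : 0 <= tau ->
  measurable_control p.1 -> {within `[0, tau], continuous p.2} ->
  (forall t, 0 <= t <= tau ->
    p.2 t = y0 + \row_i \int[leb]_(s in `[0, t]) f (p.2 s) (p.1 s) 0 i) ->
  (forall t, 0 <= t <= tau -> Z (p.2 t)) ->
  admissible_inf f Z (p.2 tau) q ->
  q.2 0 = p.2 tau /\ admissible_inf f Z y0 (concat_process p tau q).
Proof.
move=> tau0 mu cx pE Zp [mq [cq qE] Zq].
have q0 : q.2 0 = p.2 tau.
  rewrite qE// -[RHS]addr0; congr (_ + _); apply/rowP => i.
  by rewrite !mxE set_itv1 Rintegral_set1.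
pose c := concat_process p tau q.
have cE1 t : 0 <= t <= tau -> c.2 t = p.2 t.
  move=> /andP[t0 tt]; rewrite /c/= (max_l t0) min_l// max_r ?subr_le0//.
  by rewrite q0 subrr addr0.
have cE2 t : tau <= t -> c.2 t = q.2 (t - tau).
  move=> tt; rewrite /c/= max_l ?(le_trans tau0)// min_r// max_l ?subr_ge0//.
  by rewrite addrCA subrr addr0.
have cc : continuous c.2.
  have c1 : continuous (fun t : R => Num.min (Num.max t 0) tau).
    apply: (@lipschitz_continuous R R^o R^o _ 1) => s t; rewrite mul1r.
    exact: clamp_dist_le.
  have c2 : continuous (fun t : R => Num.max (t - tau) 0).
    move=> t; apply: (@continuous_comp _ _ _ (fun t : R => t - tau) (fun t => Num.max t 0)).
      by apply: cvgB; [exact: cvg_id|exact: cvg_cst].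
    exact: max0_continuous.
  have d1 : continuous (p.2 \o (fun t : R => Num.min (Num.max t 0) tau)).
    apply: (within_continuous_comp cx c1) => t /=.
    by rewrite in_itv/= le_min le_max lexx orbT tau0 ge_min lexx orbT.
  have d2 : continuous (q.2 \o (fun t : R => Num.max (t - tau) 0)).
    by apply: (within_continuous_comp cq c2) => t /=; rewrite in_itv/= andbT le_max lexx orbT.
  by move=> t; apply: cvgD; [exact: d1|apply: cvgB; [exact: d2|exact: cvg_cst]].
have mc : measurable_control c.1.
  apply: measurable_fun_if => //.
  - exact: measurable_fun_ltr.
  - by apply: (measurable_funS _ _ mu) => // t [].
  - apply: (measurable_comp _ _ mq) => //; last exact: measurable_funB.
    move=> _ [t [_ /= /negbT + <-]] /=.
    by rewrite -leNgt in_itv/= andbT subr_ge0.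
have ccw : {within `[0, +oo[, continuous c.2} by exact: continuous_subspaceT.
have Zc t : t \in `[0, +oo[ -> Z (c.2 t).
  move=> tI; have t0 : 0 <= t by move: tI; rewrite in_itv/= andbT.
  have [tt|/ltW tt] := leP t tau.
    by rewrite cE1 ?t0//; apply: Zp; rewrite t0.
  by rewrite cE2//; apply: Zq; rewrite /= in_itv/= andbT subr_ge0.
have mpc i := measurable_along (@fcoord_cont i) mc ccw.
have bpc i t := @fcoord_path c i t Zc.
have E1 t : 0 <= t <= tau -> c.2 t = y0 + \row_i \int[leb]_(s in `[0, t]) f (c.2 s) (c.1 s) 0 i.
  move=> /[dup] t0tau /andP[t0 tt]; rewrite cE1// pE//; congr (_ + _).
  apply/rowP => i; rewrite !mxE.
  (* The right end is left out: at time [tau] the concatenated control already takes the value of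
     [q]. A single point does not change the integral. *)
  have eqpc s : s \in `[0, t[%classic -> f (c.2 s) (c.1 s) 0 i = f (p.2 s) (p.1 s) 0 i.
    rewrite inE => s0t; have /andP[s0 st] : 0 <= s < t by move: s0t; rewrite /= in_itv.
    by rewrite cE1 ?s0 ?(le_trans (ltW st))// /c/= (lt_le_trans st tt).
  have ic : leb.-integrable `[0, t[ (EFin \o (fun s => f (c.2 s) (c.1 s) 0 i)).
    apply: (@eq_integrable _ RR R leb _ _ (EFin \o (fun s : RR => fcoord i (path c s)))) => //.
      by move=> s; rewrite inE/= in_itv/= => /andP[s0 _]; rewrite /= path_ge0.
    apply: measurable_bounded_integrable => //.
    - by rewrite /= lebesgue_measure_itv/=; case: ifP; rewrite ?ltry.
    - exact: (measurable_funTS (mpc i)).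
    - exists C; split; first exact: num_real.
      by move=> x Mx y _; exact: le_trans (bpc i y) (ltW Mx).
  have ip : leb.-integrable `[0, t[ (EFin \o (fun s => f (p.2 s) (p.1 s) 0 i)).
    by apply: eq_integrable ic => // s st; rewrite /= eqpc.
  rewrite -Rintegral_itv_bndo_bndc// -[RHS]Rintegral_itv_bndo_bndc//.
  by apply: eq_Rintegral => s st; rewrite eqpc.
split => //; split => //; split => // t t0.
have [tt|/ltW tt] := leP t tau; first by apply: E1; rewrite t0.
have t' : 0 <= t - tau by rewrite subr_ge0.
rewrite -/c (cE2 _ tt) qE// -(cE1 tau) ?tau0 ?lexx// E1 ?tau0 ?lexx// -addrA; congr (_ + _).
apply/rowP => i; rewrite !mxE !Rintegral_path; apply/esym.
rewrite -[X in \int[leb]_(s in `[0, X]) fcoord i (path c s) = _](subrK tau t).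
rewrite [LHS](Rintegral_translation_split tau0 t' (mpc i) (bpc i)); congr (_ + _).
apply: eq_Rintegral => r; rewrite inE/= in_itv/= => /andP[r0 _].
by rewrite path_concat.
Qed.

End measurable.

End processes.

(** * Values and dynamic programming *)

Section values.
Context {R : realType} {m : nat} {U : pmetricType R}.
Local Notation state := 'rV[R]_m.
Local Notation stateU := ('rV[R]_m * U)%type.
Local Notation RR := (measurableTypeR R).
Local Notation leb := (@lebesgue_measure R).
Local Notation process := ((R -> U) * (R -> state))%type.
Implicit Types (p q : process) (Z : set state).

(** Negative times, where [g] and [h] need not compare, form a null set by the first clause of
    [averaging]. *)
Lemma averaging_le c (P : probability RR R) (g h : RR -> R) (M N : R) :
  averaging c P ->
  measurable_fun setT g -> (forall t, `|g t| <= M) ->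
  measurable_fun setT h -> (forall t, `|h t| <= N) ->
  (forall t, 0 <= t -> g t <= h t) ->
  \int[P]_t g t <= \int[P]_t h t.
Proof.
move=> [P0 _] mg gM mh hN gh.
have ig : P.-integrable setT (EFin \o g) := bounded_integrable P mg gM.
have ih : P.-integrable setT (EFin \o h) := bounded_integrable P mh hN.
have mN : measurable (`]-oo, 0[%classic : set RR) by exact: measurable_itv.
have mD : measurable ([set: RR] `\` `]-oo, 0[%classic) by exact: measurableD.
rewrite /Rintegral (negligible_integral mN measurableT ig P0).
rewrite (negligible_integral mN measurableT ih P0).
apply: le_Rintegral => //; [exact: (integrableS measurableT)..|].
by move=> t [_ /=]; rewrite in_itv/= => /negP; rewrite -leNgt; exact: gh.
Qed.

Lemma averaging_eq c (P : probability RR R) (g h : RR -> R) (M N : R) :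
  averaging c P ->
  measurable_fun setT g -> (forall t, `|g t| <= M) ->
  measurable_fun setT h -> (forall t, `|h t| <= N) ->
  (forall t, 0 <= t -> g t = h t) ->
  \int[P]_t g t = \int[P]_t h t.
Proof.
move=> Pc mg gM mh hN gh; apply/eqP; rewrite eq_le.
rewrite (averaging_le Pc mg gM mh hN) => [|t t0]; last by rewrite gh.
by rewrite (averaging_le Pc mh hN mg gM) => [|t t0]; rewrite ?gh.
Qed.

Variables (f : state -> U -> state) (k : state -> U -> R) (Z : set state) (M C : R).
Hypothesis U_compact : compact [set: U].
Hypothesis f_cont : continuous (fun x : stateU => f x.1 x.2).
Hypothesis k_cont : continuous (fun x : stateU => k x.1 x.2).
Hypothesis fC : forall y u, Z y -> `|f y u| <= C.
Hypothesis kM : forall y u, Z y -> `|k y u| <= M.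

Definition running_cost p (t : R) : R := k (path p t).1 (path p t).2.

Lemma measurable_running_cost y p : admissible_inf f Z y p ->
  @measurable_fun _ _ RR RR setT (running_cost p).
Proof. by move=> [mu [cx _] _]; exact: (measurable_along U_compact k_cont mu cx). Qed.

Lemma running_cost_le y p t : admissible_inf f Z y p -> `|running_cost p t| <= M.
Proof.
move=> [_ _ Zp]; apply: kM; apply: Zp.
by rewrite /= in_itv/= andbT le_max lexx orbT.
Qed.

(** An infimum expressed by a lower bound and near-minimisers, with real values. Processes are
    admissible for all times even when [P] is uniform on [0, T], so that they can be shifted and
    concatenated freely. *)
Definition is_value (P : probability RR R) (v : state -> R) : Prop :=
  (forall y p, Z y -> admissible_inf f Z y p -> v y <= \int[P]_t running_cost p t) /\
  (forall y (e : R), Z y -> 0 < e ->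
    exists2 p, admissible_inf f Z y p & \int[P]_t running_cost p t <= v y + e).

(** A near-minimiser of the finite-horizon problem obeys the constraint up to [T] only; viability
    supplies a continuation from its endpoint, which the uniform law does not see. *)
Lemma is_value_V_opt (T : R) (T0 : 0 < T) : viable f Z ->
  (forall y, Z y -> V_opt f k Z T y \is a fin_num) ->
  is_value (uniform_prob T0) (fun y => fine (V_opt f k Z T y)).
Proof.
move=> Zviable Vfin.
have costE y p : admissible_inf f Z y p ->
    (T^-1%:E * \int[leb]_(t in `[0%R, T]) (k (p.2 t) (p.1 t))%:E)%E =
    (\int[uniform_prob T0]_t running_cost p t)%:E.
  move=> pZ; rewrite -(mean_uniform T0 (measurable_running_cost pZ) (fun t => running_cost_le t pZ)).
  congr (_ * _)%E; apply: eq_integral => t; rewrite inE/= in_itv/= => /andP[t0 _].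
  by rewrite /running_cost path_ge0.
split=> [y p Zy pZ|y e Zy e0].
  rewrite -lee_fin fineK ?Vfin// -(costE y)// lee_pmul2l//; last first.
    by rewrite lte_fin invr_gt0.
  apply: ereal_inf_lbound; exists p => //.
  case: pZ => mu sol Zp; split => // t; rewrite /= in_itv/= => /andP[t0 _].
  by apply: Zp; rewrite /= in_itv/= t0.
have : (ereal_inf [set \int[leb]_(t in `[0%R, T]) (k (p.2 t) (p.1 t))%:E
      | p in admissible_fin f Z T y] < (T * (fine (V_opt f k Z T y) + e))%:E)%E.
  have : (V_opt f k Z T y < (fine (V_opt f k Z T y) + e)%:E)%E.
    by rewrite -[ltLHS]fineK ?Vfin// lte_fin ltrDl.
  by rewrite EFinM -lte_pdivrMl.
move=> /ereal_inf_lt[_ [p [mu [cx xE] Zp] <-] ptest].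
have ZT : Z (p.2 T) by apply: Zp; rewrite /= in_itv/= lexx ltW.
have [q qZ] := Zviable _ ZT.
have [||||q0 cZ] := admissible_concat (p := p) (q := q) (tau := T) (y0 := y)
   U_compact f_cont fC (ltW T0) mu.
- apply: continuous_subspaceW cx => t; rewrite /= !in_itv/= => /andP[-> _] //.
- by move=> t /andP[t0 _]; exact: xE.
- by move=> t t0T; apply: Zp; rewrite /= in_itv/=.
- exact: qZ.
exists (concat_process p T q) => //.
rewrite -lee_fin -(costE y)//.
rewrite lee_pdivrMl// -EFinM; apply: (le_trans _ (ltW ptest)).
have mp (r : process) : measurable_control r.1 -> {within `[0, +oo[, continuous r.2} ->
    measurable_fun (`[0, T[%classic : set RR) (fun t => (k (r.2 t) (r.1 t))%:E).
  move=> mr cr; apply: (eq_measurable_fun (EFin \o running_cost r)).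
    by move=> t; rewrite inE/= in_itv/= => /andP[t0 _]; rewrite /running_cost path_ge0.
  apply/measurable_EFinP/measurable_funTS.
  exact: (measurable_along U_compact k_cont mr cr).
have [mc [cc _] _] := cZ.
(* Time [T] is dropped, because there the control is already that of the continuation. *)
rewrite -integral_itv_bndo_bndc; last exact: mp mc cc.
rewrite -[leRHS]integral_itv_bndo_bndc; last exact: mp mu cx.
rewrite le_eqVlt; apply/orP; left; apply/eqP; apply: eq_integral => t.
rewrite inE/= in_itv/= => /andP[t0 tT].
by rewrite tT (max_l t0) (min_l (ltW tT)) max_r ?subr_le0 ?(ltW tT)// q0 subrr addr0.
Qed.


Lemma is_value_h_opt (lambda : R) (lambda0 : 0 < lambda) :
  (forall y, Z y -> h_opt f k Z lambda y \is a fin_num) ->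
  is_value (exponential_probability lambda0) (fun y => fine (h_opt f k Z lambda y)).
Proof.
move=> hfin.
have costE y p : admissible_inf f Z y p ->
    (lambda%:E * \int[leb]_(t in `[0%R, +oo[) (expR (- lambda * t) * k (p.2 t) (p.1 t))%:E)%E =
    (\int[exponential_probability lambda0]_t running_cost p t)%:E.
  move=> pZ.
  rewrite -(mean_exponential lambda0 (measurable_running_cost pZ) (fun t => running_cost_le t pZ)).
  congr (_ * _)%E; apply: eq_integral => t; rewrite inE/= in_itv/= andbT => t0.
  by rewrite /running_cost path_ge0.
split=> [y p Zy pZ|y e Zy e0].
  rewrite -lee_fin fineK ?hfin// -(costE y)// lee_pmul2l//.
  by apply: ereal_inf_lbound; exists p.
have : (h_opt f k Z lambda y < (fine (h_opt f k Z lambda y) + e)%:E)%E.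
  by rewrite -[ltLHS]fineK ?hfin// lte_fin ltrDl.
have lE (x : \bar R) : (lambda%:E * x = (lambda^-1)^-1%:E * x)%E by rewrite invrK.
have li0 : 0 < lambda^-1 by rewrite invr_gt0.
rewrite /h_opt lE lte_pdivrMl//.
move=> /ereal_inf_lt[_ [p pZ <-] ptest].
exists p => //; rewrite -lee_fin -(costE y)//.
rewrite lE lee_pdivrMl//.
exact: ltW.
Qed.

End values.

(** * Smooth approximate subsolutions *)

Section subsolutions.
Context {R : realType} {m : nat} {U : pmetricType R}.
Local Notation state := 'rV[R]_m.
Local Notation stateU := ('rV[R]_m * U)%type.
Local Notation RR := (measurableTypeR R).
Local Notation leb := (@lebesgue_measure R).
Local Notation process := ((R -> U) * (R -> state))%type.
Implicit Types (p q : process).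

(** The extension is the infimum over [z] in [Z] of [v z + K * |x - z|]. Test functions live on the
    whole space, whereas the value is controlled on [Z] only. *)
Lemma mcshane (Z : set state) (v : state -> R) (K : R) : 0 <= K -> Z !=set0 ->
  (forall x y, Z x -> Z y -> `|v x - v y| <= K * `|x - y|) ->
  exists2 g : state -> R, klip K g & forall y, Z y -> g y = v y.
Proof.
move=> K0 [z0 Zz0] vK.
pose E x := [set v z + K * `|x - z| | z in Z].
have Elb x : has_lbound (E x).
  exists (v z0 - K * `|x - z0|) => _ [z Zz <-].
  have := vK _ _ Zz0 Zz; rewrite ler_norml => /andP[_].
  have : K * `|z0 - z| <= K * `|x - z0| + K * `|x - z|.
    rewrite -mulrDr ler_wpM2l// (distrC x z0).
    exact: ler_distD.
  by move=> ? ?; lra.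
have E0 x : E x !=set0 by exists (v z0 + K * `|x - z0|); exists z0.
have Einf x : has_inf (E x) by split.
pose g x := inf (E x).
have gle x y : g x <= g y + K * `|x - y|.
  rewrite -lerBlDr; apply: lb_le_inf => // _ [z Zz <-].
  rewrite lerBlDr; apply: (@le_trans _ _ (v z + K * `|x - z|)).
    by apply: ge_inf => //; exists z.
  rewrite -addrA lerD2l -mulrDr ler_wpM2l// [leRHS]addrC.
  exact: ler_distD.
exists g => [x y|y Zy].
  rewrite ler_norml; apply/andP; split; last by rewrite lerBlDl; exact: gle.
  by rewrite lerBrDl lerBlDr distrC; exact: gle.
apply/eqP; rewrite eq_le; apply/andP; split.
  by apply: ge_inf => //; exists y => //; rewrite subrr normr0 mulr0 addr0.
apply: lb_le_inf => // _ [z Zz <-].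
by have := vK _ _ Zy Zz; rewrite ler_norml => /andP[_]; rewrite lerBlDl.
Qed.

Variables (f : state -> U -> state) (k : state -> U -> R) (Z : set state) (M C L : R).
Hypothesis U_compact : compact [set: U].
Hypothesis f_cont : continuous (fun x : stateU => f x.1 x.2).
Hypothesis k_cont : continuous (fun x : stateU => k x.1 x.2).
Hypothesis fC : forall y u, Z y -> `|f y u| <= C.
Hypothesis kM : forall y u, Z y -> `|k y u| <= M.
Hypotheses (C0 : 0 <= C) (L0 : 0 <= L).
Hypothesis fL : forall u x y, `|f x u - f y u| <= L * `|x - y|.

Variables (c : R) (P : probability RR R) (v : state -> R).
Hypotheses (c0 : 0 <= c) (Pc : averaging c P) (vP : is_value f k Z P v).

(** The cost is not split at [tau]: [averaging_shift_le] compares the whole average with that of the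
    path translated by [tau], which is the path of the near-optimal continuation [q]. *)
Lemma value_dpp p y (tau : R) : 0 <= tau -> Z y ->
  measurable_control p.1 -> {within `[0, tau], continuous p.2} ->
  (forall t, 0 <= t <= tau ->
    p.2 t = y + \row_i \int[leb]_(s in `[0, t]) f (p.2 s) (p.1 s) 0 i) ->
  (forall t, 0 <= t <= tau -> Z (p.2 t)) ->
  v y <= v (p.2 tau) + 2 * M * c * tau.
Proof.
move=> tau0 Zy mu cx pE Zp; apply/ler_addgt0Pl => e e0.
have Zt : Z (p.2 tau) by apply: Zp; rewrite lexx tau0.
have [q qZ qe] := vP.2 _ _ Zt e0.
have [q0 cZ] := admissible_concat U_compact f_cont fC tau0 mu cx pE Zp qZ.
apply: (le_trans (vP.1 _ _ Zy cZ)).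
have mc := measurable_running_cost U_compact k_cont cZ.
have bc t := running_cost_le kM t cZ.
apply: (le_trans (averaging_shift_le Pc c0 tau0 mc bc)).
rewrite addrA lerD2r; apply: (le_trans _ (le_trans qe _)); last by rewrite addrC.
rewrite le_eqVlt; apply/orP; left; apply/eqP.
apply: (averaging_eq Pc (M := M) (N := M)).
- apply: (measurableT_comp mc); exact: measurable_funD.
- by move=> t; exact: bc.
- exact: (measurable_running_cost U_compact k_cont qZ).
- by move=> t; exact: (running_cost_le kM t qZ).
- by move=> t t0; rewrite /running_cost path_concat.
Qed.

(** Under the constant control [u] the arc stays within [2 * C * tau] of [y], so its velocity
    differs from [f y u] by at most [2 * L * C * tau]. Integrating over [0, tau] and using [vK]
    gives the quadratic term. *)
Lemma value_step (K r tau : R) y u : 0 <= K ->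
  (forall x y, Z x -> Z y -> `|v x - v y| <= K * `|x - y|) ->
  (forall z, `|z - y| <= r -> Z z) ->
  0 < tau -> L * tau <= 2^-1 -> 2 * C * tau <= r ->
  v y <= v (y + tau *: f y u) + (2 * M * c * tau + 2 * K * L * C * tau ^+ 2).
Proof.
move=> K0 vK ballZ tau0 Ltau Ctau.
have Ct0 : 0 <= 2 * C * tau by rewrite !mulr_ge0// ltW.
have Zy : Z y by apply: ballZ; rewrite subrr normr0 (le_trans Ct0).
have [x [cx xE xy]] := picard y L0 tau0 Ltau (fL u).
have xC t : 0 <= t <= tau -> `|x t - y| <= 2 * C * tau.
  move=> /[dup] tt /andP[t0 tt']; apply: (le_trans (xy _ tt)).
  by rewrite ler_pM ?mulr_ge0// ler_wpM2l// fC.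
have Zx t : 0 <= t <= tau -> Z (x t).
  by move=> tt; apply: ballZ; apply: (le_trans (xC _ tt)).
have tau0' := ltW tau0.
have H : v y <= v (x tau) + 2 * M * c * tau.
  apply: (@value_dpp (cst u, x)) => //=; first exact: measurable_cst.
  exact: continuous_subspaceT.
apply: (le_trans H); rewrite addrCA [leRHS]addrC lerD2r -lerBlDl.
have tt : 0 <= tau <= tau by rewrite tau0' lexx.
have Zy' : Z (y + tau *: f y u).
  apply: ballZ; rewrite addrC addKr normrZ gtr0_norm//.
  apply: (le_trans _ Ctau); rewrite mulrC ler_wpM2r//.
  by apply: (le_trans (fC u Zy)); have := C0; lra.
apply: (le_trans (ler_norm _)); apply: (le_trans (vK _ _ (Zx _ tt) Zy')).
rewrite (xE _ tt) opprD addrACA subrr add0r -(vint_cst _ tau0').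
have cF : continuous (fun s => f (x s) u).
  move=> s; apply: (@continuous_comp _ _ _ x (fun y => f y u) s (cx s)).
  exact: (@lipschitz_continuous R state state _ L (fL u)).
rewrite vintB//; last by move=> s; exact: cvg_cst.
apply: (@le_trans _ _ (K * (L * (2 * C * tau) * tau))); last first.
  by rewrite le_eqVlt; apply/orP; left; apply/eqP; ring.
rewrite ler_wpM2l//; apply: vint_le => //; first by rewrite mulr_ge0.
  by move=> s; apply: cvgB; [exact: cF|exact: cvg_cst].
move=> s ts; apply: (le_trans (fL _ _ _)); rewrite ler_wpM2l//.
exact: xC.
Qed.

(* Mollifying the extended value function keeps the approximate subsolution
   inequality, up to the oscillation of f at the mollification scale. *)
Lemma subsolution_test (K r e : R) (Y : set state) : 0 <= K -> 0 < r -> 0 < e -> 2 * e <= r ->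
  Z !=set0 ->
  (forall x y, Z x -> Z y -> `|v x - v y| <= K * `|x - y|) ->
  (forall y z, Y y -> `|z - y| <= r -> Z z) ->
  exists h, [/\ C1 h, forall y, Y y -> `|h y - v y| <= e &
    forall y u, Y y -> - (2 * M * c + K * L * e) <= grad_dot f h (y, u)].
Proof.
move=> K0 r0 e0 er Z0 vK YZ.
have [g gK gv] := mcshane K0 Z0 vK.
have [h [hC1 hg hA]] := mollification K0 e0 gK.
exists h; split => // [y Yy|y u Yy].
  by rewrite -gv//; apply: (YZ y) => //; rewrite subrr normr0 ltW.
rewrite grad_dot_derive//=.
(* The first bound makes Picard iteration contract; the second keeps arcs of length [tau] within
   distance [e] of their start. *)
pose tau0 := Num.min (2^-1 / (L + 1)) (e / (2 * (C + 1))).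
have L1 : 0 < L + 1 by rewrite ltr_wpDl.
have C1' : 0 < C + 1 by rewrite ltr_wpDl.
have t00 : 0 < tau0 by rewrite lt_min !divr_gt0// mulr_gt0.
apply: (@derive_ge _ _ h y (f y u) _ (2 * K * L * C) tau0) => // tau /andP[t0 tt].
have Lt : L * tau <= 2^-1.
  apply: (@le_trans _ _ ((L + 1) * tau)); first by rewrite ler_wpM2r ?lerDl// ltW.
  rewrite mulrC -ler_pdivlMr//; apply: ltW; apply: (lt_le_trans tt).
  by rewrite /tau0 ge_min lexx.
have Ct : 2 * C * tau <= e.
  apply: (@le_trans _ _ ((2 * (C + 1)) * tau)).
    by rewrite ler_wpM2r ?ler_wpM2l ?lerDl// ltW.
  rewrite mulrC -ler_pdivlMr ?mulr_gt0//; apply: ltW; apply: (lt_le_trans tt).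
  by rewrite /tau0 ge_min lexx orbT.
(* The inequality is needed at every point [y + s] met by the smoothing; [2 * e <= r] leaves a ball
   of radius [e] around each of them inside [Z]. *)
apply: hA => s se.
pose y' := y + s.
have y'y : `|y' - y| <= e by rewrite /y' addrC addKr.
have Zs z : `|z - y'| <= e -> Z z.
  move=> zy'; apply: (YZ y) => //; apply: (le_trans _ er).
  by apply: (le_trans (ler_distD y' _ _)); rewrite mulr_natl mulr2n lerD.
have Zy' : Z y' by apply: Zs; rewrite subrr normr0 ltW.
have t0' := ltW t0.
have Zty' : Z (y' + tau *: f y' u).
  apply: Zs; rewrite addrC addKr normrZ gtr0_norm//.
  apply: (le_trans _ Ct); rewrite mulrC ler_wpM2r//.
  by apply: (le_trans (fC u Zy')); have := C0; lra.
rewrite -/y' gv//; apply: (le_trans (value_step u K0 vK Zs t0 Lt Ct)).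
(* The mollifier admits one common displacement, so the velocity at [y'] is replaced by that at [y].
   This is the origin of the term [K * L * e]. *)
suff : v (y' + tau *: f y' u) <= g (y' + tau *: f y u) + K * L * e * tau by lra.
rewrite -(gv _ Zty') -lerBlDl; apply: (le_trans (ler_norm _)); apply: (le_trans (gK _ _)).
rewrite opprD addrACA subrr add0r -scalerBr normrZ gtr0_norm//.
apply: (@le_trans _ _ (K * (tau * (L * e)))).
  rewrite ler_wpM2l// ler_wpM2l//; apply: (le_trans (fL _ _ _)).
  by rewrite ler_wpM2l.
by rewrite le_eqVlt; apply/orP; left; apply/eqP; ring.
Qed.

End subsolutions.

(** * Occupational measures *)

Section stationary.
Context {R : realType} {m : nat} {U : pmetricType R}.
Local Notation state := 'rV[R]_m.
Local Notation stateU := ('rV[R]_m * U)%type.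
Local Notation RR := (measurableTypeR R).
Local Notation leb := (@lebesgue_measure R).
Local Notation process := ((R -> U) * (R -> state))%type.
Implicit Types (p : process).

Lemma probability_tail (P : probability RR R) (e : R) : 0 < e ->
  exists2 N : R, 0 <= N & fine (P `]N, +oo[%classic) <= e.
Proof.
move=> e0.
pose F n : set RR := `]n%:R, +oo[%classic.
have mF n : measurable (F n) by exact: measurable_itv.
have F0 : \bigcap_n F n = set0.
  apply/seteqP; split=> // x /= Fx.
  have := Fx (Num.trunc `|x|).+1 I; rewrite /F/= in_itv/= andbT.
  apply/negP; rewrite -leNgt (le_trans (ler_norm _))//.
  exact/ltW/truncnS_gt.
have ndF : nonincreasing_seq F.
  move=> a b ab; apply/subsetPset => x; rewrite /F/= !in_itv/= !andbT.
  by apply: le_lt_trans; rewrite ler_nat.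
have cF : P (F n) @[n --> \oo] --> 0%E.
  rewrite -(measure0 P) -F0; apply: nonincreasing_cvg_mu => //.
  - by rewrite (le_lt_trans (probability_le1 P (mF 0%N)))// ltry.
  - by rewrite F0.
have : \forall n \near \oo, fine (P (F n)) < e.
  by have := cvgr_lt _ (fine_cvg cF); apply.
by move=> [n _ /(_ n (leqnn n)) Pn]; exists n%:R => //; exact: ltW.
Qed.

Lemma bounded_Fubini (P Q : probability RR R) (h : RR -> RR) (M : R) :
  measurable_fun setT h -> (forall t, `|h t| <= M) ->
  [/\ measurable_fun setT (fun s : RR => \int[P]_t h (t + s)),
    forall s, `|\int[P]_t h (t + s)| <= M &
    \int[Q]_s \int[P]_t h (t + s) = \int[P]_t \int[Q]_s h (s + t)].
Proof.
move=> mh hM.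
pose H (z : RR * RR) := (h (z.2 + z.1))%:E.
have mH : measurable_fun setT H.
  apply/measurable_EFinP; apply: (measurableT_comp mh).
  by apply: measurable_funD; [exact: measurable_snd|exact: measurable_fst].
have M0 : 0 <= M := le_trans (normr_ge0 _) (hM 0).
have mt s : measurable_fun setT (fun t : RR => h (t + s)).
  by apply: (measurableT_comp mh); exact: measurable_funD.
have it (S : probability RR R) s : S.-integrable setT (EFin \o (fun t => h (t + s))).
  exact: bounded_integrable (mt s) (fun t => hM (t + s)).
have bt (S : probability RR R) s : `|\int[S]_t h (t + s)| <= M.
  have iM : S.-integrable setT (EFin \o cst M) by exact: finite_measure_integrable_cst.
  apply: (le_trans (le_normr_Rintegral _ (it S s))) => //.
  apply: (@le_trans _ _ (\int[S]_t M)).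
    by apply: le_Rintegral => //; exact: (integrable_norm (it S s)).
  by rewrite Rintegral_cst// (congr1 fine (probability_setT S)) mulr1.
have iH (S : probability RR R) : (Q \x S)%E.-integrable setT H.
  have mH2 : measurable_fun setT (fun z : RR * RR => h (z.2 + z.1)) by exact/measurable_EFinP.
  apply: (@measurable_bounded_integrable _ _ R (Q \x S)%E _ setT) => //.
    rewrite -setXTT [X in (X < _)%E]product_measure1E// [X in (X * _)%E]probability_setT mul1e.
    by rewrite [X in (X < _)%E]probability_setT ltry.
  exists M; split; first exact: num_real.
  by move=> x Mx z _; exact: le_trans (hM _) (ltW Mx).
have EE (S : probability RR R) s : (\int[S]_t h (t + s))%:E = (\int[S]_t (h (t + s))%:E)%E.
  by rewrite EFin_Rintegral//; exact: it.
have mP (S : probability RR R) : measurable_fun setT (fun s : RR => \int[S]_t h (t + s)).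
  have /= := measurable_fubini_F (iH S); rewrite /fubini_F /H/=.
  by under eq_fun do rewrite -EE; move=> /measurable_EFinP.
split => //.
apply: EFin_inj; rewrite !EFin_Rintegral//; last 2 first.
- exact: bounded_integrable (mP Q) (bt Q).
- exact: bounded_integrable (mP P) (bt P).
under eq_integral do rewrite EE.
under [RHS]eq_integral do rewrite EE.
rewrite (Fubini (iH P)) /H/=.
by apply: eq_integral => s _; apply: eq_integral => t _; rewrite addrC.
Qed.

End stationary.

Section occupation.
Context {R : realType} {m : nat} {U : pmetricType R}.
Local Notation state := 'rV[R]_m.
Local Notation stateU := ('rV[R]_m * U)%type.
Local Notation RR := (measurableTypeR R).
Local Notation leb := (@lebesgue_measure R).
Local Notation process := ((R -> U) * (R -> state))%type.
Implicit Types (p : process).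

Variables (f : state -> U -> state) (k : state -> U -> R) (Z Y : set state) (M C : R).
Hypothesis U_compact : compact [set: U].
Hypothesis f_cont : continuous (fun x : stateU => f x.1 x.2).
Hypothesis k_cont : continuous (fun x : stateU => k x.1 x.2).
Hypothesis fC : forall y u, Z y -> `|f y u| <= C.
Hypothesis kM : forall y u, Z y -> `|k y u| <= M.
Hypothesis YZ : Y `<=` Z.

Lemma admissible_infS y p : admissible_inf f Y y p -> admissible_inf f Z y p.
Proof. by move=> [mu sol Yp]; split => // t /Yp /YZ. Qed.

Variables (c : R) (P : probability RR R) (v : state -> R).
Hypotheses (Pc : averaging c P) (vP : is_value f k Z P v).

Lemma mean_bound (Q : probability RR R) (h : RR -> R) : measurable_fun setT h ->
  (forall t, `|h t| <= M) -> `|\int[Q]_t h t| <= M.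
Proof.
move=> mh hM; have [_ + _] := bounded_Fubini Q Q mh hM => /(_ 0).
by under eq_Rintegral do rewrite addr0.
Qed.

Lemma value_bound y : Z y -> `|v y| <= M.
Proof.
move=> Zy; have bd p : admissible_inf f Z y p -> `|\int[P]_t running_cost k p t| <= M.
  move=> pZ; apply: mean_bound; first exact: measurable_running_cost pZ.
  by move=> t; exact: (running_cost_le kM t pZ).
rewrite ler_norml; apply/andP; split.
  apply/ler_addgt0Pl => e e0; have [p pZ pe] := vP.2 y e Zy e0.
  by have := bd p pZ; rewrite ler_norml => /andP[? _]; lra.
have [p pZ _] := vP.2 y 1 Zy ltr01.
by have := bd p pZ; rewrite ler_norml => /andP[_]; apply: le_trans; exact: vP.1.
Qed.

(* The value at the running state is at most the averaged future cost; swapping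
   the two averages, the future cost differs from the present one by the
   translation defect of the slow average. *)
Lemma occupation_value_le (g : state -> R) (c0 c' N e : R) (P' : probability RR R) y p :
  continuous g -> (forall y, Y y -> g y = v y) ->
  0 <= c' <= c0 -> averaging c' P' -> 0 <= N -> fine (P `]N, +oo[%classic) <= e ->
  admissible_inf f Y y p ->
  \int[P']_s g (path p s).1 <= \int[P']_s running_cost k p s + (2 * M * c0 * N + 2 * M * e).
Proof.
move=> cg gv /andP[c'0 c'c0] Pc' N0 Pe pY.
have pZ := admissible_infS pY.
have mk := measurable_running_cost U_compact k_cont pZ.
have bk t := running_cost_le kM t pZ.
have M0 : 0 <= M := le_trans (normr_ge0 _) (bk 0).
have Yp t : Y (path p t).1.
  by case: pY => _ _; apply; rewrite /= in_itv/= andbT le_max lexx orbT.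
have [mI bI FE] := bounded_Fubini P P' mk bk.
have [mI' bI' _] := bounded_Fubini P' P mk bk.
have mg : measurable_fun [set: RR] (fun s : RR => g (path p s).1).
  case: pZ => mu [cx _] _.
  apply: (measurable_along (h := fun x : stateU => g x.1) U_compact _ mu cx).
  move=> x; apply: (@continuous_comp _ _ _ (fun x : stateU => x.1) g); last exact: cg.
  exact: cvg_fst.
have step1 : \int[P']_s g (path p s).1 <= \int[P']_s \int[P]_t running_cost k p (t + s).
  apply: (averaging_le Pc' (M := M) (N := M)) => // [s|s s0].
    by rewrite gv//; exact/value_bound/YZ.
  have psZ := admissible_infS (admissible_shift U_compact f_cont (fun y u Yy => fC u (YZ Yy)) s0 pY).
  have Zs : Z (p.2 s) by have := Yp s; rewrite path_ge0// => /YZ.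
  rewrite gv// path_ge0//=; apply: (le_trans (vP.1 _ _ Zs psZ)).
  rewrite le_eqVlt; apply/orP; left; apply/eqP.
  apply: (averaging_eq Pc (M := M) (N := M)) => //.
  - exact: (measurable_running_cost U_compact k_cont psZ).
  - by move=> t; exact: (running_cost_le kM t psZ).
  - by apply: (measurableT_comp mk); exact: measurable_funD.
  - by move=> t t0; rewrite /running_cost path_shift.
apply: (le_trans step1); rewrite FE.
pose A := \int[P']_s running_cost k p s.
pose tail : set RR := `]N, +oo[%classic.
have mtail : measurable tail by exact: measurable_itv.
have Ab : `|A| <= M by exact: mean_bound.
have cN : 0 <= 2 * M * c0 * N by rewrite !mulr_ge0// (le_trans c'0).
pose B := A + 2 * M * c0 * N.
have mt : measurable_fun [set: RR] (fun t : RR => 2 * M * \1_tail t).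
  by apply: measurable_funM => //; exact: measurable_indic.
have bt t : `|2 * M * (\1_tail t : R)| <= 2 * M.
  rewrite indicE normrM ger0_norm ?mulr_ge0//.
  by case: (t \in tail); rewrite ?normr1 ?normr0 ?mulr1 ?mulr0// mulr_ge0.
have it : P.-integrable setT (EFin \o (fun t : RR => 2 * M * \1_tail t)).
  exact: (bounded_integrable P mt bt).
have i1 : P.-integrable setT (EFin \o (\1_tail : RR -> R)).
  apply: (bounded_integrable P (M := 1)); first exact: measurable_indic.
  by move=> t; rewrite indicE; case: (t \in tail); rewrite ?normr1 ?normr0.
have iB : P.-integrable setT (EFin \o cst B) by exact: finite_measure_integrable_cst.
(* Pointwise in the delay [t]: up to [N] the translation defect is at most [2 * M * c0 * N]; beyond
   [N] the trivial bound [2 * M] is charged to the tail of [P]. *)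
apply: (@le_trans _ _ (\int[P]_t (B + 2 * M * \1_tail t))).
  apply: (averaging_le Pc (M := M) (N := `|B| + 2 * M)) => //.
  - exact: measurable_funD.
  - by move=> t; apply: (le_trans (ler_normD _ _)); rewrite lerD2l.
  - move=> t t0; rewrite /B.
    have [tN|tN] := leP t N.
      have /ler_normlW := averaging_shift Pc' c'0 t0 mk bk.
      have : 2 * M * c' * t <= 2 * M * c0 * N.
        by rewrite ler_pM ?mulr_ge0// ler_wpM2l// mulr_ge0.
      have : 0 <= 2 * M * (\1_tail t : R) by rewrite !mulr_ge0// indicE.
      by rewrite -/A => ? ? ?; lra.
    have tailt : tail t by rewrite /tail/= in_itv/= tN.
    rewrite indicE mem_set// mulr1.
    have := bI' t; rewrite ler_norml => /andP[_].
    by move: Ab; rewrite ler_norml => /andP[? _] ?; lra.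
rewrite RintegralD// RintegralZl// Rintegral_cst// (congr1 fine (probability_setT P)) mulr1.
rewrite /B -addrA lerD2l lerD2l ler_wpM2l ?mulr_ge0//.
by rewrite /Rintegral integral_indic// setIT.
Qed.

End occupation.

(** * Occupational measures in the weak topology *)

Section weak_approximation.
Context {R : realType} {m : nat} {U : pmetricType R}.
Local Notation state := 'rV[R]_m.
Local Notation stateU := ('rV[R]_m * U)%type.
Local Notation borelYU := (borelType stateU).
Local Notation RR := (measurableTypeR R).
Local Notation process := ((R -> U) * (R -> state))%type.
Implicit Types (p : process) (Y : set state).

Lemma measurable_YU Y : closed Y -> measurable (YU Y : set borelYU).
Proof.
move=> cY; rewrite -[YU Y]setCK; apply: measurableC; apply: sub_sigma_algebra.
rewrite (_ : ~` YU Y = fst @^-1` (~` Y)).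
  by apply: open_comp; [move=> x _; exact: cvg_fst|exact: closed_openC].
by apply/seteqP; split=> x /=; [move=> nx Yx; apply: nx|move=> nx [Yx _]; exact: nx].
Qed.

(** [h] is controlled on [YU Y] only, so preimages of open intervals are shown to be traces on
    [YU Y] of an open set [O]. *)
Lemma measurable_lipschitz_YU Y (L : R) (h : stateU -> R) : closed Y ->
  (forall y y' (u u' : U), Y y -> Y y' ->
    `|h (y, u) - h (y', u')| <= L * (`|y - y'| + mdist u u')) ->
  @measurable_fun _ _ borelYU RR (YU Y) h.
Proof.
move=> cY hL; have mY := measurable_YU cY.
apply: (measurability _ (RGenOpens.measurableE R)) => _ [W' [a [b ->]] <-].
set W := `]a, b[%classic; have oW : open W by exact: interval_open.
pose O : set stateU := \bigcup_(V in [set V | open V /\ YU Y `&` V `<=` h @^-1` W]) V.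
have oO : open O by apply: bigcup_open => V [].
rewrite (_ : _ `&` _ = YU Y `&` O); first by apply: measurableI => //; exact: sub_sigma_algebra.
apply/seteqP; split=> [[y u] [Yyu Wyu]|x [Yx [V [oV VW] Vx]]]; last first.
  by split => //; exact: VW.
split=> //.
have [r /= r0 rW] : nbhs_ball (h (y, u)) W by apply/nbhs_ballP; exact: open_nbhs_nbhs.
have L1 : 0 < `|L| + 1 by rewrite ltr_wpDl.
pose d := r / (2 * (`|L| + 1)).
have d0 : 0 < d by rewrite divr_gt0// mulr_gt0.
pose N : set stateU := ball y d `*` ball u d.
have nN : nbhs (y, u) N by exists (ball y d, ball u d) => //=; split; exact: nbhsx_ballx.
exists (interior N); last exact: nbhs_singleton (nbhs_interior nN).
split; first exact: open_interior.
move=> [y' u'] [[Yy' _] /interior_subset [/= yy' uu']]; apply: rW; rewrite -ball_normE/=.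
apply: (le_lt_trans (hL _ _ _ _ Yyu.1 Yy')).
move: yy' uu'; rewrite -ball_normE ballEmdist/= => yy' uu'.
have dd : (`|L| + 1) * (d + d) = r.
  by rewrite /d; field; rewrite gt_eqF.
rewrite -[ltRHS]dd.
apply: (@le_lt_trans _ _ ((`|L| + 1) * (`|y - y'| + mdist u u'))).
  rewrite ler_wpM2r ?addr_ge0 ?mdist_ge0// (le_trans (ler_norm _))// lerDl//.
by rewrite ltr_pM2l// ltrD.
Qed.

Lemma Rintegral_le_add (mu : probability borelYU R) (D : set borelYU) (g h : borelYU -> R)
    (B e : R) : measurable D -> (mu D = 1)%E ->
  measurable_fun D g -> measurable_fun D h -> 0 <= e ->
  (forall x, D x -> `|g x| <= B) -> (forall x, D x -> `|h x| <= B) ->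
  (forall x, D x -> g x <= h x + e) ->
  \int[mu]_(x in D) g x <= \int[mu]_(x in D) h x + e.
Proof.
move=> mD D1 mg mh e0 gB hB gh.
have muD : (mu D < +oo)%E by rewrite D1 ltry.
have ig : mu.-integrable D (EFin \o g).
  apply: measurable_bounded_integrable => //.
  exists B; split; first exact: num_real.
  by move=> x Bx z Dz; exact: le_trans (gB z Dz) (ltW Bx).
have ih : mu.-integrable D (EFin \o h).
  apply: measurable_bounded_integrable => //.
  exists B; split; first exact: num_real.
  by move=> x Bx z Dz; exact: le_trans (hB z Dz) (ltW Bx).
have ie : mu.-integrable D (EFin \o cst e) by exact: finite_measure_integrable_cst.
have -> : \int[mu]_(x in D) h x + e = \int[mu]_(x in D) (h x + e).
  by rewrite RintegralD// Rintegral_cst// [X in _ * fine X]D1 mulr1.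
apply: le_Rintegral => //.
have := integrableD mD ih ie; exact.
Qed.

(** The common form of [Gamma] and [Theta]: the distribution of the path at a random time whose law
    [P] has rate at most [c0]. *)
Definition occ_set (f : state -> U -> state) Y (c0 : R) : set (probability borelYU R) :=
  [set gam | exists (c : R) (P : probability RR R) y p,
    [/\ 0 <= c <= c0, averaging c P, admissible_inf f Y y p &
      forall Q : set borelYU, measurable Q -> gam Q = P ((path p : RR -> borelYU) @^-1` Q)]].

Lemma occ_set_Rintegral (P : probability RR R) (gam : probability borelYU R) p Y (h : borelYU -> RR) (B : R) :
  closed Y -> @measurable_fun _ _ RR borelYU setT (path p) ->
  (forall t, YU Y (path p t)) ->
  (forall Q : set borelYU, measurable Q -> gam Q = P ((path p : RR -> borelYU) @^-1` Q)) ->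
  measurable_fun setT h -> (forall x, YU Y x -> `|h x| <= B) ->
  gam (YU Y) = 1%E /\ \int[gam]_(x in YU Y) h x = \int[P]_t h (path p t).
Proof.
move=> cY mp Yp gP mh hB; have mY := measurable_YU cY.
have pY : path p @^-1` YU Y = setT by apply/seteqP; split=> // t _; exact: Yp.
split; first by rewrite gP// pY probability_setT.
rewrite /Rintegral; congr fine.
have mhp : @measurable_fun _ _ RR RR setT (fun t => h (path p t)).
  exact: (measurableT_comp mh mp).
transitivity (\int[P]_(t in path p @^-1` YU Y) ((EFin \o h) \o path p) t)%E; last by rewrite pY.
rewrite -(integral_pushforward mp)//.
- by apply: eq_measure_integral => A mA _; rewrite /= gP.
- exact/measurable_EFinP.
- rewrite pY; apply: (bounded_integrable P mhp (M := B)) => t; exact/hB/Yp.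
Qed.

Lemma conv_hull_Rintegral_le (G : set (probability borelYU R)) (gam : probability borelYU R)
    (D : set borelYU) (h : borelYU -> R) (a B : R) :
  measurable D -> measurable_fun D h -> (forall x, D x -> `|h x| <= B) ->
  (forall mu, G mu -> mu D = 1%E /\ \int[mu]_(x in D) h x <= a) ->
  conv_hull G gam -> gam D = 1%E /\ \int[gam]_(x in D) h x <= a.
Proof.
move=> mD mh hB Gh [n [w [g [w0 w1 Gg gamE]]]].
(* Weights with sum 1 exclude an empty combination; a successor bound makes [inord] available for
   extending the family to all natural indices, as [msum] requires. *)
have [n' nE] : exists n', n = n'.+1.
  case: n w g w0 w1 Gg gamE => [w g w0 w1|n' *]; last by exists n'.
  by move: w1; rewrite big_ord0 => /eqP; rewrite eq_sym oner_eq0.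
subst n.
have gD : gam D = 1%E.
  rewrite gamE// -w1 -sumEFin; apply: eq_bigr => i _.
  by rewrite (Gh _ (Gg i)).1 mule1.
split => //.
pose m_ (j : nat) := mscale (NngNum (w0 (inord j))) (g (inord j)).
have gamm A : measurable A -> gam A = msum m_ n'.+1 A.
  move=> mA; rewrite gamE// /msum; apply: eq_bigr => i _.
  by rewrite /m_ /mscale/= inord_val.
(* Adding [B] makes the integrand nonnegative, so its integral splits over a sum of measures. *)
have shift (mu : probability borelYU R) : mu D = 1%E ->
    (\int[mu]_(x in D) (h x + B)%:E)%E = (\int[mu]_(x in D) h x + B)%:E.
  move=> muD1; have muD : (mu D < +oo)%E by rewrite muD1 ltry.
  have ih : mu.-integrable D (EFin \o h).
    apply: measurable_bounded_integrable => //.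
    exists B; split; first exact: num_real.
    by move=> x Bx z Dz; exact: le_trans (hB z Dz) (ltW Bx).
  have iB : mu.-integrable D (EFin \o cst B) by exact: finite_measure_integrable_cst.
  under eq_integral do rewrite EFinD.
  by rewrite integralD// integral_cst// [X in (_ + _ * X)%E]muD1 mule1 EFinD EFin_Rintegral.
have h0 x : D x -> (0 <= (h x + B)%:E)%E.
  by move=> /hB; rewrite ler_norml lee_fin => /andP[]; lra.
have mhB : measurable_fun D (fun x => (h x + B)%:E).
  by apply/measurable_EFinP; exact: measurable_funD.
have : (\int[gam]_(x in D) (h x + B)%:E <= (a + B)%:E)%E.
  rewrite (eq_measure_integral (msum m_ n'.+1)); last by move=> A mA _; exact: gamm.
  rewrite ge0_integral_measure_sum//.
  apply: (@le_trans _ _ (\sum_(i < n'.+1) (w i * (a + B))%:E)%E).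
    apply: lee_sum => i _; rewrite ge0_integral_mscale//= inord_val.
    have [gi1 gia] := Gh _ (Gg i).
    by rewrite shift// -EFinM lee_fin ler_wpM2l// lerD2r.
  by rewrite sumEFin -mulr_suml w1 mul1r.
by rewrite shift// lee_fin lerD2r.
Qed.

End weak_approximation.

Section limit_occupational_measures.
Context {R : realType} {m : nat} {U : pmetricType R}.
Local Notation state := 'rV[R]_m.
Local Notation stateU := ('rV[R]_m * U)%type.
Local Notation borelYU := (borelType stateU).
Local Notation RR := (measurableTypeR R).
Local Notation leb := (@lebesgue_measure R).
Local Notation process := ((R -> U) * (R -> state))%type.
Implicit Types (p : process) (Y : set state) (q : nat -> stateU -> R).

Lemma rho_lt_term Y q (g1 g2 : probability borelYU R) j (e : R) :
  (rho Y q g1 g2 < (2^-1 ^+ j.+1 * e)%:E)%E ->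
  `|\int[g1]_(x in YU Y) q j x - \int[g2]_(x in YU Y) q j x| < e.
Proof.
set d := `|_|; move=> rlt.
have p0 i : 0 < (2^-1 : R) ^+ i by rewrite exprn_gt0.
rewrite -(ltr_pM2l (p0 j.+1)) -lte_fin; apply: le_lt_trans rlt.
rewrite /rho; apply: le_trans (nneseries_lim_ge j.+1 _); last first.
  by move=> i _ _; rewrite lee_fin mulr_ge0// ltW.
rewrite big_nat_recr//= -[leLHS]add0e leeD2r//.
by apply: sume_ge0 => i _; rewrite lee_fin mulr_ge0// ltW.
Qed.

(** Scaled into the unit ball, [G] is uniformly close to a single [q j], and closeness for [rho]
    controls the integral of that one function. An upper bound valid on [occ_set] passes to convex
    combinations, then to [gam]. *)
Lemma stationary_Rintegral_le0 (f : state -> U -> state) Y q (gam : probability borelYU R)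
    (G : stateU -> R) (B : R) :
  closed Y -> dense_lipschitz_seq Y q -> gam (YU Y) = 1%E ->
  continuous G -> 0 < B -> (forall x, YU Y x -> `|G x| <= B) ->
  (forall c0 e : R, 0 < c0 -> 0 < e ->
    exists2 gam', conv_hull (occ_set f Y c0) gam' & (rho Y q gam gam' < e%:E)%E) ->
  (forall a : R, 0 < a -> exists2 c0 : R, 0 < c0 & forall mu, occ_set f Y c0 mu ->
    mu (YU Y) = 1%E /\ \int[mu]_(x in YU Y) G x <= a) ->
  \int[gam]_(x in YU Y) G x <= 0.
Proof.
move=> cY [qL q1 qdense] gam1 cG B0 GB approx occ.
apply/ler_addgt0Pl => a0 a00; rewrite addr0.
(* One quarter each for [G] against [B * q j] under [gam] and under [gam'], for the [rho] distance,
   and for the bound on occupational measures. *)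
pose a := a0 / 4; have a_gt0 : 0 < a by rewrite divr_gt0.
have mY := measurable_YU (U := U) cY.
have aB0 : 0 < a / B by rewrite divr_gt0.
have [j qj] : exists j, forall x, (Y `*` [set: U]) x -> `|q j x - B^-1 * G x| < a / B.
  apply: qdense => //.
    apply: continuous_subspaceT => x; apply: cvgM; first exact: cvg_cst.
    exact: cG.
  by move=> x Yx; rewrite normrM gtr0_norm ?invr_gt0// -[leRHS](mulVf (lt0r_neq0 B0))
    ler_pM2l ?invr_gt0//; exact: GB.
have mq : @measurable_fun _ _ borelYU RR (YU Y) (q j).
  by have [L qLj] := qL j; exact: measurable_lipschitz_YU qLj.
have mBq : @measurable_fun _ _ borelYU RR (YU Y) (fun x => B * q j x).
  exact: measurable_funM.
have mG : @measurable_fun _ _ borelYU RR (YU Y) G.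
  exact: (measurable_funTS (continuous_measurable_stateU cG)).
have iq (mu : probability borelYU R) : mu (YU Y) = 1%E -> mu.-integrable (YU Y) (EFin \o q j).
  move=> mu1; apply: (@measurable_bounded_integrable _ borelYU R mu) => //.
    by rewrite [X in (X < _)%E]mu1 ltry.
  exists 1; split; first exact: num_real.
  by move=> x x1 z Yz; exact: le_trans (q1 j z Yz) (ltW x1).
have BqB x : YU Y x -> `|B * q j x| <= B.
  by move=> Yx; rewrite normrM gtr0_norm// ler_piMr ?(ltW B0)// q1.
have BqG x : YU Y x -> - a <= B * q j x - G x <= a.
  move=> Yx; rewrite -ler_norml.
  have -> : B * q j x - G x = B * (q j x - B^-1 * G x).
    by rewrite mulrBr mulVKf ?lt0r_neq0.
  rewrite normrM gtr0_norm// mulrC -ler_pdivlMr//; exact/ltW/qj.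
have [c0 c00 occa] := occ a a_gt0.
have e0 : 0 < 2^-1 ^+ j.+1 * (a / B) by rewrite mulr_gt0// exprn_gt0.
have [gam' gam'conv /rho_lt_term gamd] := approx c0 _ c00 e0.
have [gam'1 gam'G] := conv_hull_Rintegral_le mY mG GB occa gam'conv.
have s1 : \int[gam]_(x in YU Y) G x <= \int[gam]_(x in YU Y) (B * q j x) + a.
  apply: (Rintegral_le_add (B := B)) => //; first exact: ltW.
  by move=> x /BqG; lra.
have s2 : \int[gam']_(x in YU Y) (B * q j x) <= \int[gam']_(x in YU Y) G x + a.
  apply: (Rintegral_le_add (B := B)) => //; first exact: ltW.
  by move=> x /BqG; lra.
move: s1 s2; rewrite !RintegralZl//; [|exact: iq..] => s1 s2.
have s3 : B * (\int[gam]_(x in YU Y) q j x) <= B * (\int[gam']_(x in YU Y) q j x) + a.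
  rewrite -lerBlDl -mulrBr mulrC -ler_pdivlMr//.
  exact: le_trans (ler_norm _) (ltW gamd).
have aE : a0 = 4 * a by rewrite /a mulrC divfK.
by rewrite aE; lra.
Qed.

(** A single index [t], far enough along the filter, serves both requirements: the supremum over [W]
    inside [rho_H] is below [e], and [Gam t] lies in [Occ], which makes its hull a part of the hull
    of [Occ]. *)
Lemma rho_H_approx (T : Type) (F : set_system T) (Y : set state) q
    (Gam : T -> set (probability borelYU R)) (W Occ : set (probability borelYU R))
    (gam : probability borelYU R) (e : R) :
  ProperFilter F ->
  rho_H Y q (conv_hull (Gam t)) W @[t --> F] --> 0%E ->
  (\forall t \near F, Gam t `<=` Occ) -> W gam -> 0 < e ->
  exists2 gam', conv_hull Occ gam' & (rho Y q gam gam' < e%:E)%E.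
Proof.
move=> FF rF GO Wgam e0.
have ne : nbhs (0%E : \bar R) [set x | (x < e%:E)%E].
  by apply: open_nbhs_nbhs; split; [exact: open_ereal_lt_ereal|rewrite /= lte_fin].
have [t [Gt rt]] := filter_ex (filterI GO (rF _ ne)).
have : (rho_set Y q gam (conv_hull (Gam t)) < e%:E)%E.
  apply: le_lt_trans rt; rewrite /rho_H le_max; apply/orP; right.
  by apply: ereal_sup_ubound; exists gam.
move=> /ereal_inf_lt[_ [gam' gam'G <-] rg]; exists gam' => //.
have [n [w [g [w0 w1 Gg gE]]]] := gam'G.
by exists n, w, g; split => // i; exact/Gt/Gg.
Qed.

Variables (f : state -> U -> state) (Y : set state) (C : R).
Hypothesis U_compact : compact [set: U].
Hypothesis f_cont : continuous (fun x : stateU => f x.1 x.2).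
Hypothesis fC : forall y u, Y y -> `|f y u| <= C.

Lemma measurable_path_preimage y p (Q : set borelYU) : admissible_inf f Y y p ->
  measurable Q -> measurable ((path p : RR -> borelYU) @^-1` Q).
Proof.
move=> [mu [cx _] _] mQ; rewrite -[X in measurable X]setTI.
by apply: (measurable_path U_compact mu cx).
Qed.

Lemma indic_le1 (A : set RR) t : `|\1_A t : R| <= 1.
Proof. by rewrite indicE; case: (t \in A); rewrite ?normr1 ?normr0. Qed.

Lemma indic_Rintegral (P : probability RR R) (A : set RR) : measurable A ->
  (\int[P]_t (\1_A t : R))%:E = P A.
Proof.
move=> mA; rewrite EFin_Rintegral//; first by rewrite integral_indic// setIT.
apply: (bounded_integrable P (M := 1)); first exact: measurable_indic.
exact: indic_le1.
Qed.

(** A process constrained up to [T] is prolonged by viability to one admissible for all times; the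
    uniform law on [0, T] ignores the prolongation, and the endpoint [T] is null. *)
Lemma Gamma_occ_set (T c0 : R) : 0 < T -> T^-1 <= c0 -> viable f Y ->
  Gamma f Y T `<=` occ_set f Y c0.
Proof.
move=> T0 Tc0 Yviable gam [y [p [Yy [mu [cx xE] Yp] gamE]]].
have YT : Y (p.2 T) by apply: Yp; rewrite /= in_itv/= lexx ltW.
have [r rY] := Yviable _ YT.
have [||||r0 cY] := admissible_concat (p := p) (q := r) (tau := T) (y0 := y)
   U_compact f_cont fC (ltW T0) mu.
- by apply: continuous_subspaceW cx => t; rewrite /= !in_itv/= => /andP[-> _].
- by move=> t /andP[t0 _]; exact: xE.
- by move=> t t0T; apply: Yp; rewrite /= in_itv/=.
- exact: rY.
pose p' := concat_process p T r.
exists T^-1, (uniform_prob T0), y, p'; split => //.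
- by rewrite invr_ge0 ltW.
- exact: averaging_uniform.
move=> Q mQ; rewrite gamE//.
have mQ' := measurable_path_preimage cY mQ.
rewrite /= uniform_probE//; congr (_ * _)%E.
rewrite -integral_indic//.
have pp' : {in (`[0%R, T[%classic : set RR), (fun t => (\1_((path p' : RR -> borelYU) @^-1` Q) t)%:E : \bar R) =1
    (fun t => (\1_Q (p.2 t, p.1 t))%:E)}.
  move=> t; rewrite inE/= in_itv/= => /andP[t0 tT]; congr (_%:E).
  rewrite /= !indicE; congr (_%:R); congr nat_of_bool.
  apply/idP/idP; rewrite !inE/= path_ge0//= tT (max_l t0) (min_l (ltW tT)) max_r ?subr_le0 ?(ltW tT)//;
    by rewrite r0 subrr addr0.
have mi : measurable_fun (`[0%R, T[%classic : set RR)
    (fun t => (\1_((path p' : RR -> borelYU) @^-1` Q) t : R)%:E).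
  by apply/measurable_EFinP/measurable_funTS; exact: measurable_indic.
rewrite -[RHS]integral_itv_bndo_bndc// -integral_itv_bndo_bndc//; last exact: eq_measurable_fun pp' mi.
by apply: eq_integral => t tT; rewrite pp'.
Qed.

Lemma Theta_occ_set (lambda c0 : R) : 0 < lambda -> lambda <= c0 ->
  Theta f Y lambda `<=` occ_set f Y c0.
Proof.
move=> l0 lc0 gam [y [p [Yy pY gamE]]].
exists lambda, (exponential_probability l0), y, p; split => //.
- by rewrite ltW.
- exact: averaging_exponential.
move=> Q mQ; rewrite gamE//.
have mQ' := measurable_path_preimage pY mQ.
rewrite -indic_Rintegral//.
have mi : @measurable_fun _ _ RR RR setT (\1_((path p : RR -> borelYU) @^-1` Q)).
  exact: measurable_indic.
rewrite -(mean_exponential l0 mi (indic_le1 _)).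
congr (_ * _)%E; apply: eq_integral => t; rewrite inE/= in_itv/= andbT => t0.
congr (_ * _)%:E; rewrite !indicE; congr (_%:R); congr nat_of_bool.
by apply/idP/idP; rewrite !inE/= path_ge0.
Qed.

End limit_occupational_measures.

(** * Enlarged constraint sets and uniform bounds *)

Section enlargements.
Context {R : realType} {m : nat} {U : pmetricType R}.
Local Notation state := 'rV[R]_m.
Local Notation stateU := ('rV[R]_m * U)%type.
Implicit Types (Y : set state).

Lemma compact_norm_bound (V : normedModType R) (A : set V) : compact A ->
  exists2 B : R, 0 <= B & forall x, A x -> `|x| <= B.
Proof.
move=> /compact_bounded[M [_ AM]]; exists (`|M| + 1); first by rewrite addr_ge0.
by move=> x Ax; apply: AM => //; rewrite (le_lt_trans (ler_norm _))// ltrDl.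
Qed.

Lemma product_norm_bound (V : normedModType R) (h : stateU -> V) (A : set state) :
  compact [set: U] -> compact A -> continuous h ->
  exists2 B : R, 0 <= B & forall y u, A y -> `|h (y, u)| <= B.
Proof.
move=> cU cA ch.
have cAU : compact (h @` (A `*` [set: U])).
  apply: continuous_compact; first exact: continuous_subspaceT.
  exact: compact_setX.
have [B B0 hB] := compact_norm_bound cAU.
by exists B => // y u Ay; apply: hB; exists (y, u).
Qed.

Lemma enlarge_bounded Y (delta : R) : compact Y -> 0 <= delta ->
  exists2 A : set state, compact A & enlarge Y delta `<=` A.
Proof.
move=> /compact_norm_bound[B B0 YB] d0.
exists [set y : state | `|y| <= B + delta].
  apply: bounded_closed_compact.
    exists (B + delta); split; first exact: num_real.
    by move=> x Bx y /= yB; exact: le_trans yB (ltW Bx).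
  apply: (@closed_comp _ _ (fun y : state => `|y|) [set x | x <= B + delta]); last exact: closed_le.
  by move=> x _; exact: norm_continuous.
move=> _ [y Yy [b /= b1 <-]]; apply: (le_trans (ler_normD _ _)); apply: lerD; first exact: YB.
rewrite normrZ ger0_norm// ler_piMr//; apply: norm_rV_le => // i.
rewrite -ler_sqr ?nnegrE// expr1n real_normK ?num_real//; apply: le_trans b1.
by rewrite (bigD1 i)//= lerDl sumr_ge0// => j _; exact: sqr_ge0.
Qed.

Lemma sub_enlarge Y (delta : R) : Y `<=` enlarge Y delta.
Proof.
move=> y Yy; exists y => //; exists 0; last by rewrite scaler0 addr0.
rewrite /euclidean_closed_unit_ball/= big1// => i _.
by rewrite mxE expr0n.
Qed.

(* The norm is the supremum norm, while the enlargement uses Euclidean balls: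
   hence the factor m + 1. *)
Lemma ball_sub_enlarge Y (delta : R) : 0 < delta -> forall y z, Y y ->
  `|z - y| <= delta / (m%:R + 1) -> enlarge Y delta z.
Proof.
move=> d0 y z Yy zy; exists y => //; exists (delta^-1 *: (z - y)); last first.
  by rewrite scalerA divff ?gt_eqF// scale1r addrC subrK.
have m1 : 0 < m%:R + 1 :> R by rewrite ltr_wpDl.
rewrite /euclidean_closed_unit_ball/=.
apply: (@le_trans _ _ (\sum_(i < m) (m%:R + 1)^-1)).
  apply: ler_sum => i _; rewrite mxE.
  have b0 : `|delta^-1 * (z - y) 0 i| <= (m%:R + 1)^-1.
    rewrite normrM gtr0_norm ?invr_gt0// mulrC ler_pdivrMr// mulrC.
    exact: le_trans (coord_le_norm _ _) zy.
  have b1 : (m%:R + 1)^-1 <= 1 :> R by rewrite invf_le1// lerDr.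
  rewrite -real_normK ?num_real// expr2; apply: (le_trans _ b0).
  by rewrite ler_piMl//; exact: le_trans b0 b1.
rewrite sumr_const card_ord -[_ *+ m]mulr_natl ler_pdivrMr// mul1r lerDl//.
Qed.

Lemma grad_dot_continuous (f : state -> U -> state) (h : state -> R) :
  continuous (fun x : stateU => f x.1 x.2) -> C1 h -> continuous (grad_dot f h).
Proof.
move=> cf [_ cg].
have cc (g : stateU -> state) i : continuous g -> continuous (fun x => g x 0 i).
  move=> c x; apply: (@continuous_comp _ _ _ g (fun v : state => v 0 i)); first exact: c.
  exact: coord_continuous.
have cg1 : continuous (fun x : stateU => grad h x.1).
  move=> x; apply: (@continuous_comp _ _ _ (fun x : stateU => x.1) (grad h)); first exact: cvg_fst.
  exact: cg.
rewrite /grad_dot; elim: (index_enum 'I_m) => [|i s ih].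
  by under eq_fun do rewrite big_nil; move=> x; exact: cvg_cst.
under eq_fun do rewrite big_cons.
move=> x; apply: cvgD; last exact: ih.
by apply: cvgM; [exact: (cc _ i cg1)|exact: (cc _ i cf)].
Qed.

Lemma ereal_lipschitz_constant (A : set state) (v : state -> \bar R) :
  ereal_lipschitz A v -> exists2 K : R, 0 <= K &
    forall x y, A x -> A y -> `|fine (v x) - fine (v y)| <= K * `|x - y|.
Proof.
move=> [_ [M [Mr HM]]]; exists (`|M| + 1); first by rewrite addr_ge0.
move=> x y Ax Ay.
have := HM (`|M| + 1); rewrite (le_lt_trans (ler_norm _)) ?ltrDl// => /(_ isT).
by move=> /(_ (x, y)); apply.
Qed.

End enlargements.

(** * The limit inequality *)

Section main_inequality.
Context {R : realType} {m : nat} {U : pmetricType R}.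
Local Notation state := 'rV[R]_m.
Local Notation stateU := ('rV[R]_m * U)%type.
Local Notation borelYU := (borelType stateU).
Local Notation RR := (measurableTypeR R).
Local Notation process := ((R -> U) * (R -> state))%type.

Variables (f : state -> U -> state) (k : state -> U -> R) (Z Y : set state) (M C L r K : R).
Hypothesis U_compact : compact [set: U].
Hypothesis f_cont : continuous (fun x : stateU => f x.1 x.2).
Hypothesis k_cont : continuous (fun x : stateU => k x.1 x.2).
Hypothesis fC : forall y u, Z y -> `|f y u| <= C.
Hypothesis kM : forall y u, Z y -> `|k y u| <= M.
Hypotheses (C0 : 0 <= C) (L0 : 0 <= L) (M0 : 0 <= M) (K0 : 0 <= K) (r0 : 0 < r).
Hypothesis fL : forall u x y, `|f x u - f y u| <= L * `|x - y|.
Hypothesis Y_compact : compact Y.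
Hypothesis YZ : forall y z, Y y -> `|z - y| <= r -> Z z.

Variables (c : R) (P : probability RR R) (v : state -> R).
Hypotheses (c0 : 0 <= c) (Pc : averaging c P) (vP : is_value f k Z P v).
Hypothesis vK : forall x y, Z x -> Z y -> `|v x - v y| <= K * `|x - y|.

Variables (q : nat -> stateU -> R) (gam : probability borelYU R)
  (xi : {finite_measure set borelYU -> \bar R}).
Hypothesis q_dense : dense_lipschitz_seq Y q.
Hypothesis gamY : gam (YU Y) = 1%E.
Hypothesis approx : forall e0 e : R, 0 < e0 -> 0 < e ->
  exists2 gam', conv_hull (occ_set f Y e0) gam' & (rho Y q gam gam' < e%:E)%E.

Let YsubZ : Y `<=` Z.
Proof. by move=> y Yy; apply: (YZ Yy); rewrite subrr normr0 ltW. Qed.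

Let Y_closed : closed Y.
Proof. by apply: compact_closed => //; exact: norm_hausdorff. Qed.

Let mY : measurable (YU Y : set borelYU).
Proof. exact: measurable_YU. Qed.

Let iYU (mu : {finite_measure set borelYU -> \bar R}) (h : stateU -> R) (B : R) :
  continuous h -> (forall y u, Y y -> `|h (y, u)| <= B) ->
  mu.-integrable (YU Y) (EFin \o h).
Proof.
move=> ch hB; apply: (@measurable_bounded_integrable _ borelYU R mu) => //.
- by rewrite -ge0_fin_numE// fin_num_measure.
- exact: (measurable_funTS (continuous_measurable_stateU ch)).
- exists B; split; first exact: num_real.
  by move=> x Bx [y u] [Yy _]; exact: le_trans (hB y u Yy) (ltW Bx).
Qed.

Let continuous_fst (g : state -> R) : continuous g -> continuous (fun x : stateU => g x.1).
Proof.
move=> cg x; apply: (@continuous_comp _ _ _ (fun x : stateU => x.1) g); last exact: cg.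
exact: cvg_fst.
Qed.

(** The inequality holds along every trajectory in [Y], up to an error that vanishes as the law of
    its occupational measure slows down; applied to [g - k], weak approximation carries it to
    [gam]. *)
Lemma value_mean_le_cost (g : state -> R) : continuous g -> (forall y, Y y -> g y = v y) ->
  \int[gam]_(x in YU Y) g x.1 <= \int[gam]_(x in YU Y) k x.1 x.2.
Proof.
move=> cg gv.
have cg1 := continuous_fst cg.
have vM y : Y y -> `|g y| <= M.
  by move=> Yy; rewrite gv//; apply: (value_bound U_compact k_cont kM vP); exact: YsubZ.
have kM' y u : Y y -> `|k y u| <= M by move=> /YsubZ; exact: kM.
have ig := iYU gam cg1 (fun y u Yy => vM y Yy).
have ik := iYU gam k_cont kM'.
rewrite -subr_le0 -RintegralB//.
pose G (x : stateU) := g x.1 - k x.1 x.2.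
have cG : continuous G by move=> x; apply: cvgB; [exact: cg1|exact: k_cont].
have GB x : YU Y x -> `|G x| <= 2 * M + 1.
  case: x => y u [/= Yy _]; rewrite /G/=; apply: (le_trans (ler_normB _ _)).
  by have := vM y Yy; have := kM' y u Yy; lra.
have B0 : 0 < 2 * M + 1 by rewrite ltr_wpDl// mulr_ge0.
apply: (stationary_Rintegral_le0 Y_closed q_dense gamY cG B0 GB approx) => a a0.
have M1 : 0 < M + 1 by rewrite ltr_wpDl.
(* The tail level [e1] fixes the delay [N], which depends on [P] alone; the rate bound [e0] is
   chosen after [N]. Tail and translation defect cost [a / 2] each. *)
have e1 : 0 < a / (4 * (M + 1)) by rewrite divr_gt0// mulr_gt0.
have [N N0 PN] := probability_tail P e1.
have N1 : 0 < N + 1 by rewrite ltr_wpDl.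
pose e0 := a / (4 * (M + 1) * (N + 1)).
have e00 : 0 < e0 by rewrite divr_gt0// !mulr_gt0.
exists e0 => // mu [c' [P' [y [p [c'e0 Pc' pY muE]]]]].
have Yp t : Y (path p t).1.
  by case: pY => _ _; apply; rewrite /= in_itv/= andbT le_max lexx orbT.
have mp : @measurable_fun _ _ RR borelYU setT (path p).
  by case: pY => mu' [cx _] _; exact: measurable_path.
have [mu1 ->] := @occ_set_Rintegral _ _ _ P' mu p Y G _ Y_closed mp (fun t => conj (Yp t) I) muE
  (continuous_measurable_stateU cG) GB.
split => //.
have mgp : @measurable_fun _ _ RR RR setT (fun t => g (path p t).1).
  exact: (measurableT_comp (continuous_measurable_stateU cg1) mp).
have mkp : @measurable_fun _ _ RR RR setT (running_cost k p).
  exact: (measurableT_comp (continuous_measurable_stateU k_cont) mp).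
rewrite RintegralB//; last 2 first.
- exact: (bounded_integrable P' mgp (fun t => vM _ (Yp t))).
- exact: (bounded_integrable P' mkp (fun t => kM' _ _ (Yp t))).
rewrite lerBlDl.
have key := occupation_value_le U_compact f_cont k_cont fC kM YsubZ Pc vP cg gv c'e0 Pc' N0 PN pY.
apply: (le_trans key); rewrite lerD2l.
have h1 : 2 * M * e0 * N <= a / 2.
  have -> : a / 2 = 2 * (M + 1) * e0 * (N + 1) by rewrite /e0; field; rewrite !gt_eqF.
  have p1 : 0 <= M * e0 by rewrite mulr_ge0// ltW.
  have p2 : 0 <= e0 * N by rewrite mulr_ge0// ltW.
  by lra.
have h2 : 2 * M * (a / (4 * (M + 1))) <= a / 2.
  have -> : a / 2 = 2 * (M + 1) * (a / (4 * (M + 1))) by field; rewrite gt_eqF.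
  by move: e1; set x := a / (4 * (M + 1)) => e1; lra.
by lra.
Qed.

Lemma value_le_cost y0 : Y y0 -> Omega f Y y0 (gam, xi) ->
  v y0 <= \int[gam]_(x in YU Y) k x.1 x.2 + 2 * M * c * fine (xi (YU Y)).
Proof.
move=> Yy0 [_ _ /= test].
set Xi := fine (xi (YU Y)); set I := \int[gam]_(x in YU Y) k x.1 x.2.
have Xi0 : 0 <= Xi by exact: fine_ge0.
have Z0 : Z !=set0 by exists y0; exact: YsubZ.
have [g gK gv] := mcshane K0 Z0 vK.
have cg : continuous g by exact: (@lipschitz_continuous R state R^o g K).
have gYv y : Y y -> g y = v y by move=> /YsubZ; exact: gv.
have vM y : Y y -> `|g y| <= M.
  by move=> Yy; rewrite gYv//; apply: (value_bound U_compact k_cont kM vP); exact: YsubZ.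
have gI := value_mean_le_cost cg gYv; rewrite -/I in gI.
(* Per unit of [e] the error is 2 for replacing [v] by [h] at [y0] and under [gam], plus
   [K * L * Xi] for the gradient bound integrated against [xi]. Since [K] is fixed here, [e] can be
   sent to 0. *)
suff H e : 0 < e -> 2 * e <= r -> v y0 <= I + 2 * M * c * Xi + (2 + K * L * Xi) * e.
  apply/ler_addgt0Pl => eta eta0.
  have D0 : 0 < 2 + K * L * Xi by rewrite ltr_wpDr// !mulr_ge0.
  pose e := Num.min (r / 2) (eta / (2 + K * L * Xi)).
  have e0 : 0 < e by rewrite lt_min !divr_gt0.
  have er : 2 * e <= r by rewrite mulrC -ler_pdivlMr// ge_min lexx.
  have ee : (2 + K * L * Xi) * e <= eta.
    by rewrite mulrC -ler_pdivlMr// ge_min lexx orbT.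
  by have := H e e0 er; lra.
move=> e0 er.
have [h [hC1 hv hgrad]] := subsolution_test U_compact f_cont k_cont fC kM C0 L0 fL c0 Pc vP K0 r0 e0 er
  Z0 vK YZ.
have ch : continuous h by move=> x; apply: differentiable_continuous; case: hC1.
have cgd := grad_dot_continuous f_cont hC1.
have [B B0 gdB] := product_norm_bound U_compact Y_compact cgd.
have cv0h : continuous (fun x : stateU => h y0 - h x.1).
  by move=> x; apply: cvgB; [exact: cvg_cst|exact: (continuous_fst ch)].
have hb y : Y y -> `|h y| <= M + e.
  move=> Yy; rewrite -(subrK (v y) (h y)) addrC; apply: (le_trans (ler_normD _ _)).
  by apply: lerD; [rewrite -gYv//; exact: vM|exact: hv].
have hb2 y (u : U) : Y y -> `|h y0 - h y| <= 2 * (M + e).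
  move=> Yy; apply: (le_trans (ler_normB _ _)).
  by have := hb y Yy; have := hb y0 Yy0; lra.
have ih := iYU gam cv0h hb2.
have igd := iYU xi cgd gdB.
have := test h hC1.
rewrite -(EFin_Rintegral mY ih) -(EFin_Rintegral mY igd) -EFinD => tE'.
have {tE'} tE := EFin_inj tE'.
(* The constant lower bound meets the total mass of [xi]; through the equation of [Omega] it becomes
   an upper bound for the [gam]-mean of [h y0 - h]. *)
have T1 : - (2 * M * c + K * L * e) * Xi <= \int[xi]_(x in YU Y) grad_dot f h x.
  rewrite -[leLHS](Rintegral_cst xi mY); apply: le_Rintegral => //.
    exact: finite_measure_integrable_cst.
  by move=> [y u] [/= Yy _]; exact: hgrad.
have T2 : \int[gam]_(x in YU Y) (v y0 - g x.1) <= \int[gam]_(x in YU Y) (h y0 - h x.1) + 2 * e.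
  apply: (Rintegral_le_add (B := 2 * (M + e))) => //.
  - apply: (measurable_funTS (continuous_measurable_stateU _)) => x.
    by apply: cvgB; [exact: cvg_cst|exact: (continuous_fst cg)].
  - exact: (measurable_funTS (continuous_measurable_stateU cv0h)).
  - by rewrite mulr_ge0// ltW.
  - move=> [y u] [/= Yy _]; rewrite -gYv//; apply: (le_trans (ler_normB _ _)).
    by have := vM y Yy; have := vM y0 Yy0; lra.
  - by move=> [y u] [Yy _]; exact: hb2.
  - move=> [y u] [/= Yy _]; have := hv y Yy; have := hv y0 Yy0.
    by rewrite gYv// !ler_norml => /andP[? ?] /andP[? ?]; lra.
have T3 : \int[gam]_(x in YU Y) (v y0 - g x.1) = v y0 - \int[gam]_(x in YU Y) g x.1.
  rewrite RintegralB//.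
  - by rewrite Rintegral_cst// [X in _ * fine X]gamY mulr1.
  - exact: finite_measure_integrable_cst.
  - exact: (iYU gam (continuous_fst cg) (fun y u Yy => vM y Yy)).
by rewrite T3 in T2; lra.
Qed.

End main_inequality.

(** * Passage to the upper limit *)

Section limsup.
Context {R : realType} {m : nat} {U : pmetricType R}.
Local Notation state := 'rV[R]_m.
Local Notation stateU := ('rV[R]_m * U)%type.
Local Notation borelYU := (borelType stateU).
Local Notation RR := (measurableTypeR R).

Lemma limf_esup_le (F : set_system R) (h : R -> \bar R) (x : \bar R) :
  (forall e : R, 0 < e -> \forall t \near F, (h t <= x + e%:E)%E) -> (limf_esup h F <= x)%E.
Proof.
move=> hx; apply/lee_addgt0Pr => e e0; rewrite /limf_esup.
apply: ereal_inf_le; exists (ereal_sup (h @` [set t | (h t <= x + e%:E)%E])).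
  by exists [set t | (h t <= x + e%:E)%E] => //; exact: hx.
by apply: ge_ereal_sup => _ [t /= ht <-].
Qed.

(** Common core of (a) and (b): [c t] is the rate of the law at parameter [t], [VY] the original
    value, [VZ] the enlarged one. The order of choices matters: first delta, which determines the
    bound [M], and then [t]. *)
Lemma limsup_value_le_kstar (f : state -> U -> state) (k : state -> U -> R) (Y : set state)
    (q : nat -> stateU -> R) (delta0 : R) (F : set_system R) (c : R -> R)
    (VY : R -> state -> \bar R) (VZ : R -> R -> state -> \bar R) :
  compact [set: U] -> continuous (fun x : stateU => f x.1 x.2) ->
  (exists L : R, forall u : U, L.-lipschitz (fun y => f y u)) ->
  continuous (fun x : stateU => k x.1 x.2) -> compact Y ->
  dense_lipschitz_seq Y q -> 0 < delta0 -> ProperFilter F ->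
  (forall e : R, 0 < e -> \forall t \near F, 0 <= c t <= e) ->
  (\forall t \near F, forall delta, 0 < delta < delta0 ->
    ereal_lipschitz (enlarge Y delta) (VZ t delta) /\
    exists2 P : probability RR R, averaging (c t) P &
      is_value f k (enlarge Y delta) P (fun y => fine (VZ t delta y))) ->
  (forall y0, Y y0 ->
    (`|VY td.1 y0 - VZ td.1 td.2 y0|)%E @[td --> filter_prod F (0 : R)^'+] --> 0%E) ->
  (forall gam, W_set f Y gam -> forall e0 e : R, 0 < e0 -> 0 < e ->
    exists2 gam', conv_hull (occ_set f Y e0) gam' & (rho Y q gam gam' < e%:E)%E) ->
  forall y0, Y y0 -> (limf_esup (fun t => VY t y0) F <= kstar f k Y y0)%E.
Proof.
move=> U_compact f_cont [L0 f_lip] k_cont Y_compact q_dense d0 FF Fc Fval cV approx y0 Yy0.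
pose L := `|L0|.
have fL u x y : `|f x u - f y u| <= L * `|x - y|.
  have := f_lip u (x, y); rewrite /= => /(_ (conj I I)) H; apply: (le_trans H).
  by rewrite ler_wpM2r// ler_norm.
apply: le_ereal_inf_tmp => _ [[gam xi] om <-].
have [Wgam _ _] := om; have [gcar _] := Wgam.
have mY : measurable (YU Y : set borelYU).
  by apply: measurable_YU; apply: compact_closed => //; exact: norm_hausdorff.
have gamY : gam (YU Y) = 1%E.
  have := @probability_setC _ _ _ gam (YU Y) mY; rewrite [LHS]gcar => /esym.
  rewrite -[gam (YU Y)]fineK ?fin_num_measure// -EFinB => -[/eqP].
  by rewrite subr_eq0 => /eqP <-.
apply: limf_esup_le => e e0.
have e20 : 0 < e / 2 by rewrite divr_gt0.
have ne : nbhs (0%E : \bar R) [set x | (x < (e / 2)%:E)%E].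
  by apply: open_nbhs_nbhs; split; [exact: open_ereal_lt_ereal|rewrite /= lte_fin].
(* The joint limit yields a rectangle, so that one delta taken from [D] serves all [t] in [A]. *)
have [[A D] /= [FA D0] AD] := cV y0 Yy0 _ ne.
have [delta [[Dd dd0] dpos]] : exists delta, (D delta /\ delta < delta0) /\ 0 < delta.
  apply: (@filter_ex _ ((0 : R)^'+)); apply: filterI; last exact: nbhs_right_gt.
  by apply: filterI => //; exact: nbhs_right_lt.
pose Z := enlarge Y delta.
have [Zb Zbc ZZb] := enlarge_bounded Y_compact (ltW dpos).
have [C C0 fCb] := product_norm_bound U_compact Zbc f_cont.
have [M M0 kMb] := product_norm_bound U_compact Zbc k_cont.
have fC y u : Z y -> `|f y u| <= C by move=> /ZZb Zy; exact: fCb.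
have kM y u : Z y -> `|k y u| <= M by move=> /ZZb Zy; exact: kMb.
pose Xi := fine (xi (YU Y)).
have Xi0 : 0 <= Xi by exact: fine_ge0.
(* [M] and [Xi] are fixed before [t], so [c t <= eta] brings the term [2 * M * c t * Xi] below
   [e / 2]; the added 1 keeps the divisor positive. *)
pose eta := e / 2 / (2 * M * Xi + 1).
have D1 : 0 < 2 * M * Xi + 1 by rewrite ltr_wpDl// !mulr_ge0.
have eta0 : 0 < eta by rewrite divr_gt0.
have mk : gam.-integrable (YU Y) (EFin \o (fun x : stateU => k x.1 x.2)).
  apply: (@measurable_bounded_integrable _ borelYU R gam) => //.
  - by rewrite [X in (X < _)%E]gamY ltry.
  - exact: (measurable_funTS (continuous_measurable_stateU k_cont)).
  - exists M; split; first exact: num_real.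
    move=> x Mx [y u] [Yy _]; apply: le_trans (ltW Mx).
    by apply: kM; exact: sub_enlarge.
near=> t.
have At : A t by near: t.
have /andP[ct0 cte] : 0 <= c t <= eta by near: t; exact: Fc.
have [lipV [P Pc vP]] : ereal_lipschitz Z (VZ t delta) /\
    exists2 P : probability RR R, averaging (c t) P &
      is_value f k Z P (fun y => fine (VZ t delta y)).
  have val : forall d, 0 < d < delta0 -> ereal_lipschitz (enlarge Y d) (VZ t d) /\
      exists2 P : probability RR R, averaging (c t) P &
        is_value f k (enlarge Y d) P (fun y => fine (VZ t d y)) by near: t.
  by apply: val; rewrite dpos dd0.
have [K K0 vK] := ereal_lipschitz_constant lipV.
have Zy0 : Z y0 by exact: sub_enlarge.
have r0 : 0 < delta / (m%:R + 1) by rewrite divr_gt0// ltr_wpDl.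
have key := value_le_cost U_compact f_cont k_cont fC kM C0 (normr_ge0 L0) M0 K0 r0 fL Y_compact
  (ball_sub_enlarge dpos) ct0 Pc vP vK q_dense gamY (approx gam Wgam) Yy0 om.
have := AD (t, delta) (conj At Dd); rewrite /= => dist.
have VZfin : VZ t delta y0 \is a fin_num by exact: lipV.1.
have VYle : (VY t y0 <= VZ t delta y0 + (e / 2)%:E)%E.
  rewrite addeC -lee_subel_addr// ; apply: le_trans (ltW dist).
  exact: lee_abs.
apply: (le_trans VYle); rewrite -(fineK VZfin) -EFin_Rintegral// -!EFinD lee_fin.
have h1 : 2 * M * c t * Xi <= e / 2.
  have -> : e / 2 = eta * (2 * M * Xi + 1) by rewrite /eta divfK// gt_eqF.
  have : 2 * M * Xi * c t <= 2 * M * Xi * eta by rewrite ler_wpM2l// !mulr_ge0.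
  by have := eta0; move=> ? ?; lra.
by rewrite -/Xi in key; lra.
Unshelve. all: by end_near. Qed.

End limsup.

Theorem theorem3p3 (R : realType) (m : nat) (U : pmetricType R)
  (f : 'rV[R]_m -> U -> 'rV[R]_m) (k : 'rV[R]_m -> U -> R)
  (Y : set 'rV[R]_m) (q : nat -> 'rV[R]_m * U -> R) (delta0 : R)
  (U_compact : compact [set: U])
  (f_cont : continuous (fun x : 'rV[R]_m * U => f x.1 x.2))
  (f_lip : exists L : R, forall u : U, L.-lipschitz (fun y => f y u))
  (k_cont : continuous (fun x : 'rV[R]_m * U => k x.1 x.2))
  (Y_nonempty : Y !=set0)
  (Y_compact : compact Y)
  (Y_regular : Y = closure (interior Y))
  (Y_viable : viable f Y)
  (q_dense : dense_lipschitz_seq Y q)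
  (delta0_gt0 : 0 < delta0) :
  (A1 f Y delta0 -> A2 f k Y delta0 -> A4 f k Y -> A5 f Y q ->
    forall y0, Y y0 ->
      (limf_esup (fun T : R => V_opt f k Y T y0) +oo%R <= kstar f k Y y0)%E) /\
  (A1 f Y delta0 -> A3 f k Y delta0 -> A6 f k Y -> A7 f Y q ->
    forall y0, Y y0 ->
      (limf_esup (fun lambda : R => h_opt f k Y lambda y0) (0 : R)^'+
        <= kstar f k Y y0)%E).
Proof.
have fC : exists C, forall y u, Y y -> `|f y u| <= C.
  have [C C0 CP] := product_norm_bound U_compact Y_compact f_cont.
  by exists C.
have [C YC] := fC.
split=> [A1f A2f A4f A5f|A1f A3f A6f A7f].
- apply: (@limsup_value_le_kstar R m U f k Y q delta0 +oo (fun T => T^-1)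
    (fun T => V_opt f k Y T) (fun T delta => V_opt f k (enlarge Y delta) T)) => //.
  + move=> e e0; exists (e^-1); split; first exact: num_real.
    move=> T eT; have T0 : 0 < T by apply: lt_trans eT; rewrite invr_gt0.
    by rewrite invr_ge0 (ltW T0)/= -[e]invrK lef_pV2 ?posrE ?invr_gt0// ltW.
  + exists 0; split; first exact: num_real.
    move=> T T0 delta /[dup] d0 /andP[dpos _].
    have lipV := A2f delta T d0 T0; split => //.
    exists (uniform_prob T0); first exact: averaging_uniform.
    have [Z Zc dZ] := enlarge_bounded Y_compact (ltW dpos).
    have [M M0 kM] := product_norm_bound U_compact Zc k_cont.
    have [B B0 fB] := product_norm_bound U_compact Zc f_cont.
    apply: (@is_value_V_opt R m U f k _ M B) => //.
    * by move=> y u /dZ; exact: fB.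
    * by move=> y u /dZ; exact: kM.
    * exact: A1f.
    * exact: lipV.1.
  + move=> gam Wgam e0 e e00 epos.
    apply: (rho_H_approx (Gam := fun T => Gamma f Y T) _ A5f) => //.
    exists (e0^-1); split; first exact: num_real.
    move=> T eT; have T0 : 0 < T by apply: lt_trans eT; rewrite invr_gt0.
    apply: (Gamma_occ_set U_compact f_cont YC) => //.
    by rewrite -[e0]invrK lef_pV2 ?posrE ?invr_gt0// ltW.
- apply: (@limsup_value_le_kstar R m U f k Y q delta0 0^'+ id
    (fun lambda => h_opt f k Y lambda)
    (fun lambda delta => h_opt f k (enlarge Y delta) lambda)) => //.
  + move=> e e0; near=> t; apply/andP; split; apply: ltW; near: t.
      exact: nbhs_right_gt.
    exact: nbhs_right_lt.
  + near=> t; have t0 : 0 < t by near: t; exact: nbhs_right_gt.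
    move=> delta /[dup] d0 /andP[dpos _].
    have lipV := A3f delta t d0 t0; split => //.
    exists (exponential_probability t0); first exact: averaging_exponential.
    have [Z Zc dZ] := enlarge_bounded Y_compact (ltW dpos).
    have [M M0 kM] := product_norm_bound U_compact Zc k_cont.
    apply: (@is_value_h_opt R m U f k _ M) => //.
    * by move=> y u /dZ; exact: kM.
    * exact: lipV.1.
  + move=> gam Wgam e0 e e00 epos.
    apply: (rho_H_approx (Gam := fun lambda => Theta f Y lambda) _ A7f) => //.
    near=> t; apply: (Theta_occ_set U_compact).
      by near: t; exact: nbhs_right_gt.
    by apply: ltW; near: t; exact: nbhs_right_lt.
Unshelve. all: by end_near. Qed.
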